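(* Let $G$ be a graph of type $\mathscr{G}_{\mathrm{II}}(A,B)$ and $\tilde G$ its component graph. If $\tilde G$ has a cycle, then $G$ is an $a$-cycle for some $a\in\mathbb{Z}^+$.
   Context: A graph is a finite, connected, undirected, loopless multigraph with a root, viewed as a simple graph with edge-weight function $wt$ counting parallel edges. For $U\subseteq V$, $i\in U$, $d_U(i)=\sum_{j\notin U}wt(\{i,j\})$; a parking function of a rooted graph is an assignment $(b_i)$ of non-negative integers to the non-root vertices such that every non-empty set $U$ of non-root vertices contains $i$ with $b_i<d_U(i)$; $\mathcal{PF}(G)$ is their set. $G$ has type $\mathscr{G}_{\mathrm{II}}(A,B)$ if $V(G)=\{0\}\cup A\cup B$ with root $0$, $A=\{1,\dots,p\}$, $B=\{p+1,\dots,p+q\}$, $p,q\in\mathbb{Z}^+$; neither $G_A=G[\{0\}\cup A]$ nor $G_B=G[\{0\}\cup B]$ is connected; and $\mathcal{PF}(G)$ is invariant under $\mathfrak{S}_p\times\mathfrak{S}_q$ acting by permuting $(b_1,\dots,b_p)$ and $(b_{p+1},\dots,b_{p+q})$ separately. The component graph $\tilde G$ is the quotient of $G$ by: $u\sim v$ iff, for $S=A$ or $S=B$, $u,v\in S$ and some connected component of $G_S$ contains both; $0$ forms its own class (the $0$-node). Distinct nodes are adjacent in $\tilde G$ iff some vertex of one is adjacent in $G$ to some vertex of the other. An $a$-cycle is a cycle all of whose edges have weight $a$. *)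

(* Defs.v *)
From mathcomp Require Import all_boot all_fingroup.

Set Implicit Arguments.
Unset Strict Implicit.
Unset Printing Implicit Defensive.

(* Multigraphs on [option T], rooted at [None].  [wt u v] is the number of
   parallel edges between u and v, so u and v are adjacent iff it is nonzero. *)
Record rooted_graph (T : finType) := RootedGraph {
  wt : option T -> option T -> nat;
  wt_sym : forall u v, wt u v = wt v u;
  wt_loopless : forall u, wt u u = 0;
  wt_connected : forall u v, connect (fun x y => 0 < wt x y) u v
}.

Definition adj (T : finType) (G : rooted_graph T) : rel (option T) :=
  fun u v => 0 < wt G u v.

Definition induced_adj (T : finType) (G : rooted_graph T) (S : {set option T}) :
    rel (option T) :=
  fun u v => [&& u \in S, v \in S & adj G u v].

Definition induced_connected (T : finType) (G : rooted_graph T)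
    (S : {set option T}) : Prop :=
  {in S &, forall u v, connect (induced_adj G S) u v}.

Definition outdeg (T : finType) (G : rooted_graph T) (U : {set T}) (i : T) : nat :=
  \sum_(j : option T | j \notin [set Some k | k in U]) wt G (Some i) j.

Definition parking (T : finType) (G : rooted_graph T) (b : T -> nat) : Prop :=
  forall U : {set T}, U != set0 -> exists2 i, i \in U & b i < outdeg G U i.

(* The vertex set {0, 1, .., p + q} is encoded as [option ('I_p + 'I_q)]. *)
Definition vertexA (p q : nat) : {set option ('I_p + 'I_q)} :=
  [set Some (inl i) | i : 'I_p].

Definition vertexB (p q : nat) : {set option ('I_p + 'I_q)} :=
  [set Some (inr j) | j : 'I_q].

Definition permute (p q : nat) (s : 'S_p) (t : 'S_q)
    (b : 'I_p + 'I_q -> nat) : 'I_p + 'I_q -> nat :=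
  fun x => match x with
           | inl i => b (inl (s i))
           | inr j => b (inr (t j))
           end.

Definition typeII (p q : nat) (G : rooted_graph ('I_p + 'I_q)%type) : Prop :=
  [/\ 0 < p /\ 0 < q,
      ~ induced_connected G (None |: vertexA p q),
      ~ induced_connected G (None |: vertexB p q)
    & forall (s : 'S_p) (t : 'S_q) (b : 'I_p + 'I_q -> nat),
        parking G (permute s t b) <-> parking G b].

(* u and v lie in S and in the same component of G[{0} U S]; note that they
   may be joined through the root. *)
Definition same_comp_in (T : finType) (G : rooted_graph T) (S : {set option T}) :
    rel (option T) :=
  fun u v => [&& u \in S, v \in S & connect (induced_adj G (None |: S)) u v].

Definition comp_equiv (p q : nat) (G : rooted_graph ('I_p + 'I_q)%type) :
    rel (option ('I_p + 'I_q)) :=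
  fun u v => [|| (u == None) && (v == None),
                 same_comp_in G (vertexA p q) u v
               | same_comp_in G (vertexB p q) u v].

Definition comp_nodes (p q : nat) (G : rooted_graph ('I_p + 'I_q)%type) :
    {set {set option ('I_p + 'I_q)}} :=
  equivalence_partition (comp_equiv G) [set: option ('I_p + 'I_q)].

Definition comp_adj (p q : nat) (G : rooted_graph ('I_p + 'I_q)%type) :
    rel {set option ('I_p + 'I_q)} :=
  fun X Y => [&& X \in comp_nodes G, Y \in comp_nodes G, X != Y
               & [exists u in X, exists v in Y, adj G u v]].

Definition has_cycle (V : finType) (e : rel V) : Prop :=
  exists2 c : seq V, 2 < size c & ucycle e c.

(* G as a whole is a cycle: c lists every vertex exactly once, consecutive
   vertices (cyclically) are joined by a edges, and there are no others. *)
Definition is_weighted_cycle (T : finType) (G : rooted_graph T) (a : nat) : Prop :=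
  exists c : seq (option T),
    [/\ 2 < size c, uniq c, forall v, v \in c
      & forall u v, wt G u v =
          if (v == next c u) || (u == next c v) then a else 0].

(* Main.v *)
Require Import Defs.
From mathcomp Require Import all_boot all_fingroup zify.

Set Implicit Arguments.
Unset Strict Implicit.
Unset Printing Implicit Defensive.

(* Only parking functions with at most two nonzero entries are used.  Writing
   K(S) for the component of the root in G - S, the function with values m at x
   and n at y is parking iff m < wt(x, K(x)), n < wt(y, K(y)), and
   m < wt(x, K(x,y)) or n < wt(y, K(x,y)).  By invariance these thresholds
   depend only on the types (A or B) of x and y; so does whether the pair is
   "bad", i.e. whether the last condition is not implied by the first two.

   A cycle of the component graph produces a bad pair of mixed type, so all
   mixed pairs are bad, and this makes G 2-connected.  Then a pair is bad iff it
   is adjacent or separates G, and the weight e(x,y) from x to everything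
   outside K(x,y) is positive exactly for bad pairs.

   Pairs of the same type are bad as well: otherwise that type, say A, is
   independent and no two of its vertices separate G; but a minimal part cut off
   by a mixed pair yields two vertices of A that do, and if no mixed pair
   separates G then all mixed pairs are adjacent, which makes G_B connected.

   Now uncrossing shows that a minimal part cut off by two vertices is a clique
   joined to both, hence (G_A and G_B being disconnected) a single vertex c of
   degree 2 with neighbours x and y.  Every other nonroot vertex v is bad with
   c, so lies on every x-y path of G - c.  Thus G is a chordless Hamiltonian
   cycle, where e(x,y) is the weight of an edge at x, and comparing the values
   e(x,y) shows that all weights agree. *)

Lemma connect_inv (V : finType) (e : rel V) (P : pred V) :
    (forall u v, P u -> e u v -> P v) ->
  forall u v, connect e u v -> P u -> P v.
Proof.
move=> clP u v /connectP[p + ->]; elim: p u => //= x p IHp u /andP[ux px] Pu.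
by apply: IHp px _; apply: clP ux.
Qed.

(** * Components of the root after deleting vertices *)

Section WeightedGraph.

Variables (V : finType) (r : V) (w : V -> V -> nat).
Hypothesis w_sym : forall u v, w u v = w v u.

Definition edge_rel : rel V := fun u v => 0 < w u v.

(** The vertices of [S] stay as isolated points, so every vertex remains reachable from itself. *)
Definition without (S : {set V}) : rel V :=
  fun u v => [&& u \notin S, v \notin S & edge_rel u v].

Definition root_comp (S : {set V}) : {set V} :=
  [set v | connect (without S) r v].

Definition root_wt (S : {set V}) (x : V) : nat :=
  \sum_(v in root_comp S) w x v.

Lemma edge_sym : symmetric edge_rel.
Proof. by move=> u v; rewrite /edge_rel w_sym. Qed.

Lemma without_sym S : symmetric (without S).
Proof. by move=> u v; rewrite /without edge_sym andbCA. Qed.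

Lemma without_csym S : connect_sym (without S).
Proof. exact/sym_connect_sym/without_sym. Qed.

Lemma root_in_comp (S : {set V}) : r \in root_comp S.
Proof. by rewrite inE connect0. Qed.

Lemma root_comp_step (S : {set V}) u v :
  u \in root_comp S -> without S u v -> v \in root_comp S.
Proof. by rewrite !inE => ru uv; apply: connect_trans ru (connect1 uv). Qed.

Lemma root_compS (S S' : {set V}) : S \subset S' -> root_comp S' \subset root_comp S.
Proof.
move=> /subsetP sSS'; apply/subsetP=> v; rewrite !inE.
apply: connect_sub => x y /and3P[xS yS xy]; apply: connect1.
by rewrite /without xy (contra (sSS' x) xS) (contra (sSS' y) yS).
Qed.

Lemma root_comp_notin (S : {set V}) v : r \notin S -> v \in root_comp S -> v \notin S.
Proof.
move=> rS; rewrite inE => rv.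
by apply: (connect_inv (P := fun v => v \notin S)) rv rS => x y _ /and3P[].
Qed.

Lemma root_comp_out (S : {set V}) u v : r \notin S ->
  u \in root_comp S -> edge_rel u v -> v \in root_comp S :|: S.
Proof.
move=> rS uK uv; rewrite in_setU orbC; case: (boolP (v \in S)) => //= vS.
apply: (root_comp_step uK); apply/and3P; split=> //; exact: root_comp_notin uK.
Qed.

Lemma root_wtS (S S' : {set V}) x : S \subset S' -> root_wt S' x <= root_wt S x.
Proof.
move=> /root_compS/subsetP sKK; rewrite /root_wt big_mkcond [leqRHS]big_mkcond.
apply: leq_sum => v _; case: ifP => // /sKK ->; exact: leqnn.
Qed.

End WeightedGraph.

(** * Parking functions with small support *)

Section Parking.

Variables (T : finType) (G : rooted_graph T).
Notation rwt := (root_wt None (wt G)).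
Notation rcomp := (root_comp None (wt G)).

Lemma None_notin_Some (S : {set T}) : None \notin Some @: S.
Proof. by apply/imsetP=> -[]. Qed.

(** It suffices to test, for each [S], the set of all vertices that deleting [S] cuts off from the
    root: only members of [S] have edges leaving it, and their outdegree is their weight to the root
    component. *)
Lemma parkingP (D : {set T}) (b : T -> nat) :
    (forall x, x \notin D -> b x = 0) ->
  parking G b <->
  (forall S : {set T}, S \subset D -> S != set0 ->
     exists2 x, x \in S & b x < rwt (Some @: S) (Some x)).
Proof.
move=> b0; split=> [pb S sSD /set0Pn[x0 x0S]|H U Un0].
  pose U := [set x | Some x \notin rcomp (Some @: S)].
  have sSU x : x \in S -> x \in U.
    move=> xS; rewrite inE; apply/negP=> /root_comp_notin.
    by move=> /(_ (None_notin_Some _)); rewrite imset_f.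
  have [|x xU bx] := pb U; first by apply/set0Pn; exists x0; apply: sSU.
  have oE : outdeg G U x = rwt (Some @: S) (Some x).
    rewrite /outdeg /root_wt; apply: eq_bigl => -[y|] /=.
      by rewrite mem_imset ?inE ?negbK //; apply: Some_inj.
    by rewrite (negPf (None_notin_Some _)) root_in_comp.
  exists x; last by rewrite -oE.
  move: bx; rewrite oE => bx; apply: contraT => xS.
  have : 0 < rwt (Some @: S) (Some x) by apply: leq_ltn_trans bx.
  rewrite lt0n sum_nat_eq0 negb_forall => /existsP[v]; rewrite negb_imply.
  case/andP=> vK; rewrite -lt0n wt_sym => vx.
  have := root_comp_out (None_notin_Some _) vK vx.
  rewrite inE mem_imset ?(negPf xS) ?orbF //; last exact: Some_inj.
  by move: xU; rewrite inE => /negPf->.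
apply/exists_inP; apply: contraT => /exists_inPn bad.
have bad' x : x \in U -> outdeg G U x <= b x by move/bad; rewrite -leqNgt.
pose S := U :&: D.
(* Since [U] is violated, a vertex of [U] where [b] vanishes has no edge leaving [U]; so edges
   entering [U] from outside end in [S]. *)
have outE u x : u \notin Some @: U -> Some x \in Some @: U -> 0 < wt G u (Some x) ->
    x \in S.
  rewrite mem_imset; last exact: Some_inj.
  move=> uU xU ux; rewrite inE xU; apply: contraT => /b0 bx0.
  have := bad' x xU; rewrite bx0 leqn0 sum_nat_eq0 => /forallP/(_ u).
  by rewrite uU wt_sym -leqn0 leqNgt ux.
have KU v : v \in rcomp (Some @: S) -> v \notin Some @: U.
  rewrite inE => /(connect_inv (P := fun v => v \notin Some @: U)); apply.
    move=> u [x|] uU /and3P[_ xS ux]; last exact: None_notin_Some.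
    apply: contra xS => xU; rewrite mem_imset; last exact: Some_inj.
    exact: outE uU xU ux.
  exact: None_notin_Some.
(* If [S] is empty, the root component is the whole connected graph and would meet [U]. *)
have [S0|Sn0] := eqVneq S set0.
  have /set0Pn[x xU] := Un0.
  have : Some x \in rcomp (Some @: S).
    rewrite inE S0 imset0; apply: connect_sub (wt_connected G None (Some x)) => u v uv.
    by apply: connect1; rewrite /without !inE.
  by move/KU; rewrite imset_f.
have [x xS bx] := H S (subsetIr _ _) Sn0.
have xU : x \in U by move: xS; rewrite inE => /andP[].
have := leq_trans bx (leq_trans _ (bad' x xU)); rewrite ltnn; apply.
rewrite /root_wt /outdeg big_mkcond [leqRHS]big_mkcond.
by apply: leq_sum => v _; case: ifP => // /KU ->.
Qed.

Definition single (x : T) (m : nat) : T -> nat := fun z => if z == x then m else 0.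
Definition pairf (x : T) (m : nat) (y : T) (n : nat) : T -> nat :=
  fun z => if z == x then m else if z == y then n else 0.

Definition rdeg x := rwt [set Some x] (Some x).
Definition rwt2 x y := rwt [set Some x; Some y] (Some x).

Lemma rwt2_le x y : rwt2 x y <= rdeg x.
Proof. by apply: root_wtS; rewrite subsetUl. Qed.

Lemma parking_single x m : parking G (single x m) <-> m < rdeg x.
Proof.
rewrite (@parkingP [set x]) => [|z]; last by rewrite inE /single => /negPf->.
have sx : [set x] != set0 by apply/set0Pn; exists x; rewrite inE.
split=> [H|lt_m S].
  have [y] := H [set x] (subxx _) sx.
  by rewrite inE imset_set1 => /eqP->; rewrite /single eqxx.
rewrite subset1 => /orP[] /eqP-> => [_|/eqP//].
by exists x; rewrite ?inE // /single eqxx imset_set1.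
Qed.

Lemma rdeg_gt0 x : 0 < rdeg x.
Proof.
apply/parking_single/(@parkingP set0) => [z _|S]; first by rewrite /single if_same.
by rewrite subset0 => /eqP-> /eqP.
Qed.

(** The three conditions come from the three non-empty subsets of [{x, y}]. *)
Lemma parking_pairf x m y n : x != y ->
  parking G (pairf x m y n) <->
  [/\ m < rdeg x, n < rdeg y & (m < rwt2 x y) || (n < rwt2 y x)].
Proof.
move=> xy; have yx : (y == x) = false by rewrite eq_sym (negPf xy).
rewrite (@parkingP [set x; y]) => [|z]; last first.
  by rewrite !inE negb_or /pairf => /andP[/negPf-> /negPf->].
have n0 (S : {set T}) z : z \in S -> S != set0 by move=> zS; apply/set0Pn; exists z.
have im2 : Some @: [set x; y] = [set Some x; Some y] by rewrite imsetU !imset_set1.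
split=> [H|[Hm Hn Hmn] S sS /set0Pn[z zS]].
  split.
  - have [|z] := H [set x] (subsetUl _ _); first by apply: (n0 _ x); rewrite inE.
    by rewrite inE imset_set1 => /eqP->; rewrite /pairf eqxx.
  - have [|z] := H [set y] (subsetUr _ _); first by apply: (n0 _ y); rewrite inE.
    by rewrite inE imset_set1 => /eqP->; rewrite /pairf yx eqxx.
  - have [|z] := H _ (subxx _); first by apply: (n0 _ x); rewrite !inE eqxx.
    rewrite im2 !inE /rwt2 (setUC [set Some y]) => /orP[] /eqP->; rewrite /pairf ?yx eqxx => ->//.
    by rewrite orbT.
have Sz u : u \in S -> u \notin [set x] -> u = y.
  by move/(subsetP sS); rewrite !inE => /orP[]/eqP-> //; rewrite eqxx.
have [xS|xS] := boolP (x \in S); have [yS|yS] := boolP (y \in S).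
- have -> : S = [set x; y].
    by apply/eqP; rewrite eqEsubset sS subUset !sub1set xS yS.
  case/orP: Hmn => [Hx|Hy]; [exists x|exists y]; rewrite ?inE ?eqxx ?orbT // im2 /pairf ?yx eqxx //.
  by rewrite setUC.
- have -> : S = [set x].
    apply/eqP; rewrite eqEsubset sub1set xS andbT; apply/subsetP=> u uS.
    by apply: contraT => /(Sz u uS) uy; rewrite -uy uS in yS.
  by exists x; rewrite ?inE // imset_set1 /pairf eqxx.
- have -> : S = [set y].
    apply/eqP; rewrite eqEsubset sub1set yS andbT; apply/subsetP=> u uS.
    rewrite inE (Sz u uS) // inE; by apply: contraNN xS => /eqP<-.
  by exists y; rewrite ?inE // imset_set1 /pairf yx eqxx.
by move/(subsetP sS): (zS); rewrite !inE => /orP[]/eqP zE; rewrite -zE zS in xS yS.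
Qed.

Definition bad x y := (rwt2 x y < rdeg x) && (rwt2 y x < rdeg y).

(** * Thresholds depend only on the types *)

Section Invariant.

Variable ty : T -> bool.
Hypothesis inv : forall x y b, ty x = ty y ->
  parking G (b \o tperm x y) <-> parking G b.

Lemma eq_parking b b' : b =1 b' -> parking G b <-> parking G b'.
Proof.
by move=> bb; split=> H U /H[x xU]; rewrite (bb, =^~ bb) => ?; exists x.
Qed.

Lemma rdeg_ty x y : ty x = ty y -> rdeg x = rdeg y.
Proof.
suff le u v : ty u = ty v -> rdeg u <= rdeg v.
  by move=> xy; apply/eqP; rewrite eqn_leq !le.
move=> uv; case E: (rdeg u) => [//|m].
have /parking_single : m < rdeg u by rewrite E.
move/(inv (single u m) uv)=> H; apply/parking_single.
apply: (proj1 (eq_parking _)) H => z; rewrite /single /=.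
by rewrite -[X in _ == X](tpermR u v) (inj_eq perm_inj).
Qed.

Lemma pairf_swap1 x m y n x' : ty x = ty x' -> x != y -> x' != y ->
  parking G (pairf x m y n) <-> parking G (pairf x' m y n).
Proof.
move=> tx xy x'y; rewrite -(inv _ tx); apply: eq_parking => z.
rewrite /pairf /= -(inj_eq (@perm_inj _ (tperm x x')) z) tpermR.
by rewrite -(inj_eq (@perm_inj _ (tperm x x')) z y) (tpermD xy x'y).
Qed.

Lemma pairfC x m y n : x != y ->
  parking G (pairf x m y n) <-> parking G (pairf y n x m).
Proof.
move=> xy; apply: eq_parking => z; rewrite /pairf.
by case: eqP => [->|//]; rewrite (negPf xy).
Qed.

Lemma pairf_ty x m y n x' y' : ty x = ty x' -> ty y = ty y' -> x != y -> x' != y' ->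
  parking G (pairf x m y n) <-> parking G (pairf x' m y' n).
Proof.
move=> tx ty_y xy x'y'; have yx : y != x by rewrite eq_sym.
have y'x' : y' != x' by rewrite eq_sym.
have [x'y|x'y] := eqVneq x' y; last first.
  apply: (iff_trans (pairf_swap1 m n tx xy x'y)); apply: (iff_trans (pairfC m n x'y)).
  rewrite eq_sym in x'y.
  exact: (iff_trans (pairf_swap1 n m ty_y x'y y'x')) (pairfC n m y'x').
(* When [x' = y], replacing one position at a time would collide. All positions then have one type,
   so the two entries are first exchanged by a transposition. *)
rewrite -x'y in xy yx ty_y *.
have -> : parking G (pairf x m x' n) <-> parking G (pairf x' m x n).
  rewrite -(inv _ tx); apply: eq_parking => z; rewrite /pairf /=.
  rewrite -(inj_eq (@perm_inj _ (tperm x x')) z x') tpermR.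
  by rewrite -(inj_eq (@perm_inj _ (tperm x x')) z x) tpermL.
have tyy' : ty x = ty y' by rewrite tx.
apply: (iff_trans (pairfC m n yx)).
exact: (iff_trans (pairf_swap1 n m tyy' xy y'x')) (pairfC n m y'x').
Qed.

(** The third condition of [parking_pairf] is hardest to meet at the largest values that the first
    two allow. *)
Lemma badP x y : x != y ->
  ~~ bad x y <-> parking G (pairf x (rdeg x).-1 y (rdeg y).-1).
Proof.
move=> xy; rewrite parking_pairf // /bad negb_and -!leqNgt !prednK ?rdeg_gt0 //.
by split=> [->|[]].
Qed.

Lemma bad_ty x y x' y' : ty x = ty x' -> ty y = ty y' -> x != y -> x' != y' ->
  bad x y = bad x' y'.
Proof.
move=> tx ty_y xy x'y'; apply: negb_inj; apply/idP/idP; rewrite !badP //.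
  by rewrite (rdeg_ty tx) (rdeg_ty ty_y) (pairf_ty _ _ tx ty_y).
by rewrite -(rdeg_ty tx) -(rdeg_ty ty_y) (pairf_ty _ _ tx ty_y).
Qed.

(** For a bad pair the value [(rdeg v).-1] at [v] rules out the alternative at [v], so the threshold
    [rwt2 u v] at [u] can be read off from which functions are parking. *)
Lemma rwt2_ty x y x' y' : ty x = ty x' -> ty y = ty y' -> x != y -> x' != y' ->
    bad x y -> rwt2 x y = rwt2 x' y'.
Proof.
move=> tx ty_y xy x'y' bxy; have := bxy; rewrite (bad_ty tx ty_y xy x'y') => bx'y'.
have key u v m : u != v -> bad u v ->
    (m < rwt2 u v) <-> parking G (pairf u m v (rdeg v).-1).
  move=> uv /andP[lt1 lt2]; rewrite parking_pairf // prednK ?rdeg_gt0 //.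
  rewrite [rdeg v <= rwt2 v u]leqNgt lt2 orbF.
  by split=> [mlt|[]//]; split=> //; apply: leq_trans mlt (rwt2_le _ _).
have eqb m : (m < rwt2 x y) = (m < rwt2 x' y').
  by apply/idP/idP; rewrite !key // (rdeg_ty ty_y) (pairf_ty _ _ tx ty_y).
have := eqb (rwt2 x y); have := eqb (rwt2 x' y'); rewrite !ltnn.
by move=> /negbT + /esym/negbT; rewrite -!leqNgt => *; apply/eqP; rewrite eqn_leq; apply/andP.
Qed.

End Invariant.

End Parking.

(** * Cuts of a 2-connected graph *)

Ltac nat_lia :=
  repeat match goal with
  | H : ?P |- _ =>
    lazymatch P with
    | nat => fail
    | @eq nat _ _ => fail
    | is_true (leq _ _) => fail
    | is_true (leq _ _ && leq _ _) => fail
    | is_true (~~ (@eq_op _ (_ : nat) _)) => fail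
    | _ => clear H
    end
  end; lia.

Section TwoConnected.

Variables (V : finType) (r : V) (w : V -> V -> nat) (col : V -> bool).

Notation edge := (edge_rel w).
Notation without := (without w).
Notation comp x y := (root_comp r w [set x; y]).

Definition deg (x : V) : nat := \sum_v w x v.

(* The weight from [x] to everything that [x] and [y] cut off from the root,
   [y] itself included. *)
Definition cutoff (x y : V) : nat := \sum_(v in ~: comp x y) w x v.

Hypothesis w_sym : forall u v, w u v = w v u.
Hypothesis w_loopless : forall u, w u u = 0.
Hypothesis conn2 : forall a u v, u != a -> v != a -> connect (without [set a]) u v.
Hypothesis deg_col : forall x y, x != r -> y != r -> col x = col y -> deg x = deg y.
Hypothesis cutoff_col : forall x y x' y', x != r -> y != r -> x' != r -> y' != r ->
  x != y -> x' != y' -> col x = col x' -> col y = col y' -> cutoff x y = cutoff x' y'.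
Hypothesis cutoff_mixed : forall x y, x != r -> y != r -> col x != col y ->
  0 < cutoff x y.
Hypothesis col_disconnected : forall b, ~ forall u, u != r -> col u = b ->
  connect (fun u v => [&& (u == r) || (col u == b), (v == r) || (col v == b)
                        & edge u v]) r u.

Lemma edge_neq u v : edge u v -> u != v.
Proof. by apply: contraTneq => ->; rewrite /edge_rel w_loopless. Qed.

Lemma edgeC u v : edge u v = edge v u.
Proof. exact: edge_sym. Qed.

Lemma not_edge u v : ~~ edge u v -> w u v = 0.
Proof. by rewrite /edge_rel -eqn0Ngt => /eqP. Qed.

Definition enclosed x y (C : {set V}) : bool :=
  [forall u in C, forall v, edge u v ==> [|| v \in C, v == x | v == y]].

(** Equivalently, [C] is a non-empty union of components of the graph minus [x] and [y], none of
    them the root's. *)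
Definition sepset x y (C : {set V}) : bool :=
  [&& x != r, y != r, x != y, C != set0, r \notin C, x \notin C, y \notin C
    & enclosed x y C].

Lemma enclosedP x y (C : {set V}) :
  reflect (forall u v, u \in C -> edge u v -> [|| v \in C, v == x | v == y])
          (enclosed x y C).
Proof.
apply: (iffP forall_inP) => [H u v uC uv|H u uC].
  by have /forallP/(_ v)/implyP := H u uC; apply.
by apply/forallP=> v; apply/implyP; apply: H.
Qed.

Lemma enclosedC x y (C : {set V}) : enclosed x y C -> enclosed y x C.
Proof.
move/enclosedP => H; apply/enclosedP=> u v uC /(H u v uC).
by rewrite [(_ == x) || _]orbC.
Qed.

Lemma sepsetC x y (C : {set V}) : sepset x y C -> sepset y x C.
Proof.
case/and5P=> xr yr xy C0 /and4P[rC xC yC /enclosedC eC].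
by apply/and5P; split; rewrite // 1?eq_sym //; apply/and4P; split.
Qed.

(* Otherwise [y] would be a cut vertex. *)
Lemma enclosed_edge x y (C : {set V}) v : v \in C -> x \notin C -> y \notin C -> x != y ->
  enclosed x y C -> exists2 u, u \in C & edge u x.
Proof.
move=> vC xC yC xy /enclosedP eC; apply/exists_inP; apply: contraT => /exists_inPn nx.
have vy : v != y by apply: contraNneq yC => <-.
suff : x \in C by rewrite (negPf xC).
apply: (connect_inv (P := mem C)) (conn2 vy xy) vC => u u' uC /and3P[_ u'y uu'].
case/or3P: (eC u u' uC uu') => // /eqP E; first by rewrite E (negPf (nx u uC)) in uu'.
by rewrite E inE eqxx in u'y.
Qed.

Lemma set2_root x y : x != r -> y != r -> r \notin [set x; y].
Proof. by move=> xr yr; rewrite !inE negb_or eq_sym xr eq_sym yr. Qed.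

Lemma comp_l x y : x != r -> y != r -> x \notin comp x y.
Proof.
move=> xr yr; apply/negP=> /(root_comp_notin (set2_root xr yr)).
by rewrite !inE eqxx.
Qed.

Lemma compC x y : comp x y = comp y x.
Proof. by rewrite setUC. Qed.

Lemma comp_r x y : x != r -> y != r -> y \notin comp x y.
Proof. by move=> xr yr; rewrite compC comp_l. Qed.

Lemma sepset_comp x y (C : {set V}) v : sepset x y C -> v \in C -> v \notin comp x y.
Proof.
case/and5P=> xr yr xy C0 /and4P[rC xC yC /enclosedP eC]; apply: contraTN.
rewrite inE => /(connect_inv (P := fun v => v \notin C)); apply=> // u {}v uC.
case/and3P=> uxy _ uv; apply: contra uC => vC.
move: uxy; rewrite edgeC in uv; case/or3P: (eC v u vC uv) => // /eqP->;
  by rewrite !inE eqxx ?orbT.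
Qed.

Lemma le_cutoff2 x y u v : u != v -> u \notin comp x y -> v \notin comp x y ->
  w x u + w x v <= cutoff x y.
Proof.
move=> uv uK vK; rewrite /cutoff (bigD1 u) ?in_setC //= (bigD1 v) /=; last first.
  by rewrite in_setC vK eq_sym.
by rewrite addnA leq_addr.
Qed.

Lemma le_cutoff x y u : u \notin comp x y -> w x u <= cutoff x y.
Proof. by move=> uK; rewrite /cutoff (bigD1 u) ?in_setC //= leq_addr. Qed.

Lemma cutoff_le_deg x y u v : u != v -> u \in comp x y -> v \in comp x y ->
  cutoff x y + w x u + w x v <= deg x.
Proof.
move=> uv uK vK; rewrite /cutoff /deg [leqRHS](bigID (mem (comp x y))) /=.
rewrite [X in _ <= X + _](bigD1 u) //= [X in _ <= _ + X + _](bigD1 v) /=; last by rewrite vK eq_sym.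
rewrite (eq_bigl (fun v => v \notin comp x y)) => [|z]; last by rewrite in_setC.
by lia.
Qed.

Lemma sepset_cutoff x y (C : {set V}) : sepset x y C -> 0 < cutoff x y.
Proof.
move=> sC; case/and5P: (sC) => xr yr xy /set0Pn[v vC] /and4P[rC xC yC eC].
have [u uC] := enclosed_edge vC xC yC xy eC; rewrite edgeC => xu.
exact: leq_trans (le_cutoff (sepset_comp sC uC)).
Qed.

(** Cut-off vertices other than [x] and [y] would form a separated set; so [y] is the only one left
    to contribute to the cutoff. *)
Lemma nonsep_cutoff x y : x != r -> y != r -> x != y ->
  (forall C, ~~ sepset x y C) -> cutoff x y = w x y.
Proof.
move=> xr yr xy nC; pose C := ~: (comp x y :|: [set x; y]).
have C0 : C = set0.
  apply/eqP; apply: contraT => Cn0; case/negP: (nC C).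
  apply/and5P; split=> //; apply/and4P; split; rewrite /C ?in_setC ?in_setU ?negbK.
  - by rewrite root_in_comp.
  - by rewrite !inE eqxx orbT.
  - by rewrite !inE eqxx !orbT.
  apply/enclosedP=> u v; rewrite !(in_setC, in_setU) !negb_or => /and3P[uK ux uy] uv.
  rewrite !in_set1 in ux uy *; apply: contraT.
  rewrite !negb_or => /and3P[+ /negPf vx /negPf vy]; rewrite vx vy !andbT negbK => vK.
  rewrite edgeC in uv; have := root_comp_out (set2_root xr yr) vK uv.
  by rewrite in_setU (negPf uK) !inE (negPf ux) (negPf uy).
rewrite /cutoff (bigD1 y) ?in_setC ?comp_r //=.
rewrite big1 ?addn0 // => v /andP[]; rewrite in_setC => vK vy.
have : v \notin C by rewrite C0 inE.
by rewrite /C in_setC negbK in_setU (negPf vK) !inE (negPf vy) orbF => /eqP->.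
Qed.

Lemma deg_root_edge x : x != r -> deg x = w x r + \sum_(v | v != r) w x v.
Proof. by move=> xr; rewrite /deg (bigD1 r). Qed.

(* Vertices of colour [b] then have the same total weight to the other nonroot
   vertices, hence the same weight to the root. *)
Lemma no_root_edge b :
    (forall x z, x != r -> z != r -> col x = b -> x != z -> w x z = cutoff x z) ->
  forall x, x != r -> col x = b -> ~~ edge x r.
Proof.
move=> wE.
have eq_wr x y : x != r -> y != r -> col x = b -> col y = b -> w x r = w y r.
  move=> xr yr xb yb; have := deg_col xr yr (etrans xb (esym yb)).
  (* The transposition of [x] and [y] matches the terms [w x z] and [w y z], which are cutoffs of
     equally coloured pairs. *)
  rewrite !deg_root_edge // [in RHS](reindex_inj (@perm_inj _ (tperm x y))) /=.
  rewrite [X in _ = _ + X](eq_bigl (fun v => v != r)) => [|v]; last first.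
    by rewrite -[X in _ != X](tpermD xr yr) (inj_eq perm_inj).
  rewrite [X in _ = _ + X](eq_bigr (w x)) => [/eqP|v vr]; first by rewrite eqn_add2r => /eqP.
  case: tpermP => [->|->|/eqP vx /eqP vy]; rewrite ?w_loopless 1?w_sym //.
  have [->//|xy] := eqVneq x y.
  rewrite eq_sym in vx; rewrite eq_sym in vy; rewrite w_sym !wE //.
  by apply: cutoff_col; rewrite // xb yb.
(* If [x] is adjacent to the root, so is every vertex of colour [b], and this colour class is
   connected to the root. *)
move=> x xr xb; apply/negP=> xr_edge; apply: (@col_disconnected b) => u ur ub.
apply: connect1; rewrite eqxx ub eqxx orbT /= edgeC /edge_rel.
by rewrite -(eq_wr x u).
Qed.

(* The two cuts uncross: [C' :&: C] is again enclosed by [s] and [t]. *)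
Lemma uncross x y (C : {set V}) s t (C' : {set V}) :
    sepset x y C -> s \in C -> t \in C :|: [set x; y] ->
  sepset s t C' -> exists2 C'', sepset s t C'' & #|C''| < #|C|.
Proof.
move=> sC sinC tinC sC'.
case/and5P: (sC) => xr yr xy /set0Pn[v0 v0C] /and4P[rC xC yC /[dup] eC /enclosedP nbrC].
case/and5P: (sC') => sr tr st /set0Pn[v1 v1C'] /and4P[rC' sC'n tC'n /[dup] eC' /enclosedP nbrC'].
(* [O] is the root's side of the first cut. Edges leaving [O :\: C'] end in [x] or [y] and outside
   [C']; by 2-connectedness both [x] and [y] are such ends, so neither lies in [C']. *)
pose O := ~: (C :|: [set x; y]).
have rO : r \in O :\: C'.
  by rewrite in_setD rC' in_setC in_setU (negPf rC) set2_root.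
have nbrO u v : u \in O :\: C' -> edge u v -> (v \in O :|: [set x; y]) /\ v \notin C'.
  rewrite in_setD in_setC => /andP[uC' uO] uv; split; last first.
    apply: contra uC' => vC'; rewrite edgeC in uv.
    case/or3P: (nbrC' v u vC' uv) => // /eqP uE; case/negP: uO; rewrite uE //.
    by rewrite in_setU sinC.
  rewrite in_setU in_setC; case: (boolP (v \in [set x; y])) => vxy; rewrite ?orbT // orbF.
  apply: contra uO => /setUP[vC|]; last by rewrite (negPf vxy).
  by rewrite edgeC in uv; have := nbrC v u vC uv; rewrite !inE.
have eO : enclosed x y (O :\: C').
  apply/enclosedP=> u v uO uv; have [] := nbrO u v uO uv.
  by rewrite in_setU in_setD => /orP[-> ->//|]; rewrite !inE => ->; rewrite orbT.
have [xO yO] : x \notin O :\: C' /\ y \notin O :\: C'.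
  by rewrite !inE !eqxx !orbT !andbF.
have xC' : x \notin C'.
  by have [u uO ux] := enclosed_edge rO xO yO xy eO; case: (nbrO u x uO ux).
have yC' : y \notin C'.
  have yx : y != x by rewrite eq_sym.
  by have [u uO uy] := enclosed_edge rO yO xO yx (enclosedC eO); case: (nbrO u y uO uy).
exists (C' :&: C); last first.
  apply: proper_card; rewrite properE subsetIr /=; apply/subsetPn; exists s => //.
  by rewrite in_setI (negPf sC'n).
apply/and5P; split=> //.
  (* A neighbour of [s] in [C'] lies in [C], since [x] and [y] avoid [C']. *)
  apply/set0Pn; have [u uC' us] := enclosed_edge v1C' sC'n tC'n st eC'.
  exists u; rewrite in_setI uC' /=; rewrite edgeC in us.
  case/or3P: (nbrC s u sinC us) => // /eqP E; [case/negP: xC'|case/negP: yC'];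
    by rewrite -E.
apply/and4P; split; rewrite ?in_setI ?negb_and ?rC' ?sC'n ?tC'n //.
apply/enclosedP=> u v; rewrite !in_setI => /andP[uC' uC] uv.
case/or3P: (nbrC' u v uC' uv) => [vC'|->|->]; rewrite ?orbT // vC' /=.
case/or3P: (nbrC u v uC uv) => [->//|/eqP E|/eqP E].
  by rewrite -E vC' in xC'.
by rewrite -E vC' in yC'.
Qed.

Lemma has_col b : exists2 x, x != r & col x = b.
Proof.
suff /exists_inP[x xr /eqP xb] : [exists x in predC1 r, col x == b] by exists x.
apply: contraT => /exists_inPn H; case: (@col_disconnected b) => u ur ub.
by move: (H u ur); rewrite ub eqxx.
Qed.

Lemma enclosed1 x y c :
  (forall v, edge c v -> (v == x) || (v == y)) -> enclosed x y [set c].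
Proof. by move=> H; apply/enclosedP=> u v; rewrite inE => /eqP-> /H ->; rewrite orbT. Qed.

Lemma sepset1 x y c : x != r -> y != r -> x != y -> c != r -> c != x -> c != y ->
  (forall v, edge c v -> (v == x) || (v == y)) -> sepset x y [set c].
Proof.
move=> xr yr xy cr cx cy /enclosed1 e1; apply/and5P; split=> //.
  by apply/set0Pn; exists c; rewrite inE.
by apply/and4P; split; rewrite // in_set1 eq_sym.
Qed.

(** With the root's side enclosed by the same pair, [enclosed_edge] gives each of [x] and [y]
    neighbours on both sides. *)
Lemma sepset_compl x y (C : {set V}) (D := ~: (C :|: [set x; y])) : sepset x y C ->
  [/\ r \in D, x \notin D, y \notin D & enclosed x y D].
Proof.
case/and5P=> xr yr xy C0 /and4P[rC xC yC /enclosedP eC]; rewrite /D; split.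
- by rewrite in_setC in_setU (negPf rC) set2_root.
- by rewrite !inE eqxx orbT.
- by rewrite !inE eqxx !orbT.
apply/enclosedP=> u v; rewrite !in_setC !in_setU !in_set1 => uD uv.
case: (v == x); case: (v == y); rewrite ?orbT //= !orbF.
apply: contra uD => vC; rewrite edgeC in uv.
exact: eC uv.
Qed.

Lemma min_sepset (P : rel V) x0 y0 C0 : P x0 y0 -> sepset x0 y0 C0 ->
  exists x y C, [/\ P x y, sepset x y C &
    forall x' y' C', P x' y' -> sepset x' y' C' -> #|C| <= #|C'|].
Proof.
move=> P0 s0.
pose Q (t : V * V * {set V}) := P t.1.1 t.1.2 && sepset t.1.1 t.1.2 t.2.
have Q0 : Q (x0, y0, C0) by rewrite /Q P0.
case: (arg_minnP (fun t : V * V * {set V} => #|t.2|) Q0) => -[[x y] C] /andP[Pxy sC] minC.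
exists x, y, C; split=> // x' y' C' P' s'.
by apply: (minC (x', y', C')); rewrite /Q P'.
Qed.

Lemma exists_sepset x y : x != r -> y != r -> x != y -> 0 < cutoff x y ->
  ~~ edge x y -> exists C, sepset x y C.
Proof.
move=> xr yr xy pos /not_edge w0; apply/existsP; apply: contraT => /existsPn H.
by rewrite nonsep_cutoff // w0 in pos.
Qed.

(** * Excluding a colour whose pairs have zero cutoff *)

Section IndependentColour.

Variable b : bool.
Hypothesis cutoff0 : forall x y, x != r -> y != r -> x != y ->
  col x = b -> col y = b -> cutoff x y = 0.
Variables a1 a2 : V.
Hypotheses (a1r : a1 != r) (a2r : a2 != r) (a12 : a1 != a2).
Hypotheses (col_a1 : col a1 = b) (col_a2 : col a2 = b).

Lemma independent x y : x != r -> y != r -> col x = b -> col y = b -> w x y = 0.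
Proof.
have [->|xy] := eqVneq x y; first by rewrite w_loopless.
move=> xr yr xb yb; apply/eqP; rewrite -leqn0 -(cutoff0 xr yr xy xb yb).
by rewrite le_cutoff // comp_r.
Qed.

Lemma no_sepset_b x y (C : {set V}) : col x = b -> col y = b -> ~~ sepset x y C.
Proof.
move=> xb yb; apply/negP=> sC; have := sepset_cutoff sC.
by case/and5P: sC => xr yr xy _ _; rewrite cutoff0.
Qed.

(** A smallest set [C] cut off by a mixed pair has at most one vertex of each colour. In every case
    some set is then cut off by two vertices of colour [b], whose cutoff is zero. *)
Lemma no_sepset_mixed x y (C : {set V}) : col x = b -> col y != b -> ~~ sepset x y C.
Proof.
move=> xb0 yb0; apply/negP=> sC0.
have P0 : (col x == b) && (col y != b) by rewrite xb0 eqxx.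
case: (min_sepset (P := fun x y => (col x == b) && (col y != b)) P0 sC0).
move=> {x y C xb0 yb0 sC0 P0} x [y [C [/andP[/eqP xb yb] sC minC]]].
case/and5P: (sC) => xr yr xy /set0Pn[v0 v0C] /and4P[rC xC yC /[dup] eC /enclosedP nbrC].
have Cr c : c \in C -> c != r by apply: contraTneq => ->.
have [xs ys] : x \in C :|: [set x; y] /\ y \in C :|: [set x; y].
  by rewrite !inE !eqxx !orbT.
have colb u v : col u != b -> col v != b -> col u = col v.
  by case: (col u); case: (col v); case: b.
have pos : 0 < cutoff x y := sepset_cutoff sC.
have pos' : 0 < cutoff y x := sepset_cutoff (sepsetC sC).
(* By minimality and uncrossing, [x] and [c] do not separate, so the edge from [x] to [c] carries
   the whole cutoff and [x] has no other neighbour in [C]. The same holds for [y] and vertices of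
   colour [b]. *)
have wx c : c \in C -> col c != b -> w x c = cutoff x y.
  move=> cC cb; have xc : x != c by apply: contraNneq xC => ->.
  have cr := Cr c cC; rewrite -(@cutoff_col x c x y) ?nonsep_cutoff //; last exact: colb.
  move=> C'; apply/negP=> sC'; have [C'' s'' lt] := uncross sC cC xs (sepsetC sC').
  have := minC x c C''; rewrite xb eqxx cb => /(_ isT (sepsetC s'')).
  by rewrite leqNgt lt.
have wy c : c \in C -> col c = b -> w y c = cutoff y x.
  move=> cC cb; have yc : y != c by apply: contraNneq yC => ->.
  have yx : y != x by rewrite eq_sym.
  have cr := Cr c cC; rewrite -(@cutoff_col y c y x) ?nonsep_cutoff //; last by rewrite xb.
  move=> C'; apply/negP=> sC'; have [C'' s'' lt] := uncross sC cC ys (sepsetC sC').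
  have := minC c y C''; rewrite cb eqxx yb => /(_ isT s'').
  by rewrite leqNgt lt.
have nK v : v \in C -> v \notin comp x y by apply: sepset_comp.
have wx0 c v : c \in C -> col c != b -> v \in C -> v != c -> w x v = 0.
  move=> cC cb vC vc; have := le_cutoff2 vc (nK v vC) (nK c cC).
  by rewrite (wx c cC cb) -[leqRHS]add0n leq_add2r leqn0 => /eqP.
have wy0 c v : c \in C -> col c = b -> v \in C -> v != c -> w y v = 0.
  move=> cC cb vC vc; have := le_cutoff2 (x := y) (y := x) vc.
  rewrite compC => /(_ (nK v vC) (nK c cC)).
  by rewrite (wy c cC cb) -[leqRHS]add0n leq_add2r leqn0 => /eqP.
have [c cC cx] := enclosed_edge v0C xC yC xy eC.
have cb : col c != b.
  by apply/negP=> /eqP cb; rewrite /edge_rel (independent (Cr _ cC) xr cb xb) in cx.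
have cb_uniq v : v \in C -> col v != b -> v = c.
  move=> vC vb; apply/eqP; apply: contraT => vc.
  by have := wx v vC vb; rewrite (wx0 c v) // => E; rewrite -E in pos.
have cx' : c != x by apply: edge_neq.
have cy' : c != y by apply: contraNneq yC => <-.
(* With a second vertex [c'] of colour [b], all neighbours of [c] are [x] or [c'], so these two cut
   off [c]. *)
have [/exists_inP[c' c'C /eqP c'b]|/exists_inPn noA] := boolP [exists c' in C, col c' == b].
  have c'c : c' != c by apply: contraNneq cb => <-; rewrite c'b.
  have cc' : c != c' by rewrite eq_sym.
  have xc' : x != c' by apply: contraNneq xC => ->.
  have [cr c'r] := (Cr c cC, Cr c' c'C).
  have := @no_sepset_b x c' [set c] xb c'b.
  rewrite sepset1 // => v cv.
  case/or3P: (nbrC c v cC cv) => [vC|->//|/eqP vy].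
    have [/eqP vb|vb] := boolP (col v == b); last first.
      by have := edge_neq cv; rewrite (cb_uniq v vC vb) eqxx.
    suff -> : v = c' by rewrite eqxx orbT.
    apply/eqP; apply: contraT => vc'.
    by have := wy v vC vb; rewrite (wy0 c' v) // => E; rewrite -E in pos'.
  by move: cv; rewrite vy edgeC /edge_rel (wy0 c' c).
have CE v : v \in C -> v = c by move=> vC; apply: cb_uniq => //; apply: noA.
have nbr v : edge c v -> (v == x) || (v == y).
  move=> cv; have := nbrC c v cC cv; case: (boolP (v \in C)) => // /CE vc.
  by have := edge_neq cv; rewrite vc eqxx.
have cr := Cr c cC.
(* Now [C] is [{c}]. A further vertex [a'] of colour [b] is not adjacent to [c], so [a'] and [c]
   separate; taking [x] out of the separated set, or putting [c] into it, gives a cut by [x] and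
   [a']. *)
have [a' [a'r a'x a'b]] : exists a', [/\ a' != r, a' != x & col a' = b].
  by have [E|n1] := eqVneq a1 x; [exists a2; rewrite -E (eq_sym a2 a1)|exists a1].
have a'c : a' != c by apply: contraNneq cb => <-; rewrite a'b.
have a'y : a' != y by apply: contraNneq yb => <-; rewrite a'b.
have colc : col a' != col c by rewrite a'b eq_sym.
have na'c : ~~ edge a' c.
  by rewrite edgeC; apply/negP=> /nbr; rewrite (negPf a'x) (negPf a'y).
have [C' sC'] := exists_sepset a'r cr a'c (cutoff_mixed a'r cr colc) na'c.
case/and5P: (sC') => _ _ _ /set0Pn[v1 v1C'] /and4P[rC' a'C' cC' /[dup] eC' /enclosedP nbrC'].
have ca' : c != a' by rewrite eq_sym.
have xa' : x != a' by rewrite eq_sym.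
have [xC'|xC'] := boolP (x \in C').
  have [rD a'D cD eD] := sepset_compl sC'.
  have [u uD uc] := enclosed_edge rD cD a'D ca' (enclosedC eD).
  have yC' : y \notin C'.
    have : u \notin C' by move: uD; rewrite in_setC in_setU negb_or => /andP[].
    rewrite edgeC in uc; case/orP: (nbr u uc) => /eqP-> //; by rewrite xC'.
  (* If [x] were all of [C'], it would be adjacent to [a'], which has its own colour. *)
  have [C'x0|C'x] := eqVneq (C' :\ x) set0.
    have [v vC' va'] := enclosed_edge v1C' a'C' cC' a'c eC'.
    have /eqP vx : v == x.
      apply: contraT => vx; have : v \in C' :\ x by rewrite in_setD1 vx.
      by rewrite C'x0 inE.
    by rewrite vx /edge_rel (independent xr a'r xb a'b) in va'.
  have := @no_sepset_b x a' (C' :\ x) xb a'b; case/negP.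
  apply/and5P; split=> //; apply/and4P.
  split; rewrite ?in_setD1 ?negb_and ?rC' ?a'C' ?eqxx ?orbT //.
  apply/enclosedP=> v v'; rewrite !in_setD1 => /andP[vx vC'] vv'.
  case: (boolP (v' == x)) => // _; case/or3P: (nbrC' v v' vC' vv') => [->//|->|/eqP v'c].
    by rewrite !orbT.
  rewrite v'c edgeC in vv'; case/orP: (nbr v vv') => [|/eqP E]; first by rewrite (negPf vx).
  by rewrite E (negPf yC') in vC'.
have [u uC' uc] := enclosed_edge v1C' cC' a'C' ca' (enclosedC eC').
have yC' : y \in C'.
  rewrite edgeC in uc; case/orP: (nbr u uc) => /eqP E; last by rewrite -E.
  by rewrite -E uC' in xC'.
have := @no_sepset_b x a' (c |: C') xb a'b; case/negP.
apply/and5P; split=> //; first by apply/set0Pn; exists c; rewrite !inE eqxx.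
apply/and4P; split; rewrite ?in_setU1 ?negb_or ?rC' ?a'C' ?xC' ?andbT 1?eq_sym //.
apply/enclosedP=> v v'; rewrite !in_setU1 => /orP[/eqP->|vC'] vv'.
  by case/orP: (nbr v' vv') => /eqP->; rewrite ?eqxx ?yC' ?orbT.
by case/or3P: (nbrC' v v' vC' vv') => ->; rewrite ?orbT.
Qed.

Lemma edge_mixed x y : x != r -> y != r -> col x = b -> col y != b -> edge x y.
Proof.
move=> xr yr xb yb; have xy : x != y by apply: contraNneq yb => <-; rewrite xb.
apply: contraT => nxy.
have cxy : col x != col y by rewrite xb eq_sym.
have [C sC] := exists_sepset xr yr xy (cutoff_mixed xr yr cxy) nxy.
by have := no_sepset_mixed C xb yb; rewrite sC.
Qed.

(** Vertices of different colours are adjacent, so [z] is at most two mixed edges away from a vertex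
    of [S], through [a1] if necessary; [a1] has colour [b] and is neither [s] nor [t]. *)
Lemma sepset_other s t (S : {set V}) z : sepset s t S -> col s != b -> col t != b ->
  z != r -> col z != b -> [|| z \in S, z == s | z == t].
Proof.
move=> sS sb tb zr zb; case/and5P: (sS) => _ _ _ /set0Pn[v0 v0S] /and4P[rS _ _ /enclosedP nbr].
have v0r : v0 != r by apply: contraNneq rS => <-.
have [v0b|v0b] := boolP (col v0 == b).
  by apply: nbr v0S _; apply: edge_mixed => //; apply/eqP.
have a1S : [|| a1 \in S, a1 == s | a1 == t].
  by apply: nbr v0S _; rewrite edgeC edge_mixed.
case/or3P: a1S => [a1S|/eqP E|/eqP E]; last 2 first.
- by rewrite -E col_a1 eqxx in sb.
- by rewrite -E col_a1 eqxx in tb.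
by apply: nbr a1S _; apply: edge_mixed.
Qed.

Lemma independent_false : False.
Proof.
have noA x : x != r -> col x = b -> ~~ edge x r.
  apply: no_root_edge => {}x z xr zr xb xz; apply/esym/nonsep_cutoff => // C.
  have [/eqP zb|zb] := boolP (col z == b); first exact: no_sepset_b.
  exact: no_sepset_mixed.
have colN z : (col z == ~~ b) = (col z != b) by case: (col z); case: b.
(* If no pair of the other colour separates either, no vertex is adjacent to the root, which is
   absurd. *)
have [/existsP[j /existsP[j' /existsP[C]]]|] :=
  boolP [exists j, exists j', exists C, [&& col j != b, col j' != b & sepset j j' C]]; last first.
  rewrite negb_exists => /forallP noB.
  have noB' x : x != r -> col x = ~~ b -> ~~ edge x r.
    apply: no_root_edge => {}x z xr zr /eqP; rewrite colN => xb xz.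
    apply/esym/nonsep_cutoff => // C; apply/negP.
    have [/eqP zb|zb] := boolP (col z == b) => sC.
      by have := no_sepset_mixed C zb xb; rewrite sepsetC.
    by move: (noB x); rewrite negb_exists => /forallP/(_ z)/existsP[]; exists C; rewrite xb zb.
  have noE v : edge r v -> (v == a1) || (v == a2).
    move=> rv; have vr : v != r by rewrite eq_sym edge_neq.
    rewrite edgeC in rv; have [/eqP vb|] := boolP (col v == b).
      by rewrite (negPf (noA v vr vb)) in rv.
    by rewrite -colN => /eqP vb; rewrite (negPf (noB' v vr vb)) in rv.
  have [||u] := enclosed_edge (set11 r) _ _ a12 (enclosed1 noE).
  - by rewrite in_set1.
  - by rewrite in_set1.
  - by rewrite in_set1 edgeC => /eqP->; rewrite (negPf (noA _ _ _)).
case/and3P=> jb j'b sC; case/and5P: (sC) => jr j'r jj' _ /and4P[rC jC j'C /enclosedP nbr].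
(* Neighbours of the root have the other colour, so they lie in [C] or equal [j] or [j']; and [C]
   has no edge to the root. *)
have rnbr v : edge r v -> (v == j) || (v == j').
  move=> rv; have vr : v != r by rewrite eq_sym edge_neq.
  rewrite edgeC in rv; have vb : col v != b by apply: contraL rv => /eqP; apply: noA.
  case/or3P: (sepset_other sC jb j'b vr vb) => [vC|->//|->]; last by rewrite orbT.
  by have := nbr v r vC rv; rewrite (negPf rC) !(eq_sym r) (negPf jr) (negPf j'r).
have [rj rj'] : edge r j /\ edge r j'.
  have e := enclosed1 rnbr; have j'j : j' != j by rewrite eq_sym.
  split.
    by have [||u] := enclosed_edge (set11 r) _ _ jj' e; rewrite in_set1 // => /eqP->.
  by have [||u] := enclosed_edge (set11 r) _ _ j'j (enclosedC e); rewrite in_set1 // => /eqP->.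
apply: (@col_disconnected (~~ b)) => u ur /eqP ub.
have rjc : connect (fun u v => [&& (u == r) || (col u == ~~ b),
      (v == r) || (col v == ~~ b) & edge u v]) r j.
  by apply: connect1; rewrite eqxx /= (colN j) jb orbT.
have [->//|uj] := eqVneq u j.
have [->|uj'] := eqVneq u j'; first by apply: connect1; rewrite eqxx /= (colN j') j'b orbT.
apply: connect_trans rjc (connect1 _); rewrite ub (colN j) jb !orbT /=.
rewrite colN in ub; rewrite edgeC; apply: contraT => nuj.
(* If [u] and [j] were not adjacent they would separate, with [j'] on the side cut off, although
   [j'] is adjacent to the root. *)
have pos : 0 < cutoff u j.
  have colE v v' : col v != b -> col v' != b -> col v = col v'.
    by case: (col v); case: (col v'); case: b.
  by rewrite (@cutoff_col u j j j') ?(sepset_cutoff sC) //; apply: colE.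
have [S sS] := exists_sepset ur jr uj pos nuj.
case/or3P: (sepset_other sS ub jb j'r j'b) => [j'S||]; last 2 first.
- by rewrite eq_sym (negPf uj').
- by rewrite eq_sym (negPf jj').
case/and5P: (sS) => _ _ _ _ /and4P[rS _ _ /enclosedP nbrS].
rewrite edgeC in rj'; have := nbrS j' r j'S rj'.
by rewrite (negPf rS) !(eq_sym r) (negPf ur) (negPf jr).
Qed.

End IndependentColour.

(** * Minimal cuts and a vertex of degree two *)

Lemma cutoff_gt0 x y : x != r -> y != r -> x != y -> 0 < cutoff x y.
Proof.
move=> xr yr xy; rewrite lt0n; apply/negP=> /eqP c0.
have cxy : col x = col y.
  by apply/eqP; apply: contraT => /(cutoff_mixed xr yr); rewrite c0.
(* One pair of a colour with zero cutoff makes the cutoff zero for all pairs of that colour. *)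
apply: (@independent_false (col x) _ x y) => // u v ur vr uv uc vc.
by rewrite (@cutoff_col u v x y) // vc.
Qed.

Lemma exists_degree2 : exists c x y,
  [/\ [/\ c != r, x != r, y != r & x != y], edge c x, edge c y &
      forall v, edge c v -> (v == x) || (v == y)].
Proof.
have [a ar ab] := has_col true; have [a' a'r a'b] := has_col false.
have aa' : a != a' by apply: contraTneq ab => ->; rewrite a'b.
have [/existsP[x0 /existsP[y0 /existsP[C0 s0]]]|] :=
  boolP [exists x, exists y, exists C, sepset x y C]; last first.
  rewrite negb_exists => /forallP no.
  (* Without separating pairs every weight between nonroot vertices is a cutoff, so [no_root_edge]
     would isolate the root. *)
  have noE x : x != r -> ~~ edge x r.
    move=> xr; apply: (no_root_edge (b := col x)) => // {}x z {}xr zr _ xz.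
    apply/esym/nonsep_cutoff => // C; apply/negP=> sC.
    by move: (no x); rewrite negb_exists => /forallP/(_ z)/existsP[]; exists C.
  have e : enclosed a a' [set r].
    apply: enclosed1 => v rv; have vr : v != r by rewrite eq_sym edge_neq.
    by rewrite edgeC (negPf (noE v vr)) in rv.
  have [||u] := enclosed_edge (set11 r) _ _ aa' e; rewrite in_set1 //.
  by move=> /eqP->; rewrite edgeC (negPf (noE _ ar)).
have [x [y [C [_ sC minC]]]] := min_sepset (P := fun _ _ => true) isT s0.
case/and5P: (sC) => xr yr xy /set0Pn[c cC] /and4P[rC xC yC /[dup] eC /enclosedP nbrC].
have Cr v : v \in C -> v != r by apply: contraTneq => ->.
have Cxy v : v \in C :|: [set x; y] -> v != r.
  by rewrite !inE => /or3P[/Cr//|/eqP->|/eqP->].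
(* A non-adjacent pair here would separate and, uncrossed with [C], give a smaller separated set. *)
have clique s t : s \in C -> t \in C :|: [set x; y] -> s != t -> edge s t.
  move=> sinC tinC st; apply: contraT => nst.
  have [S sS] := exists_sepset (Cr s sinC) (Cxy t tinC) st
                   (cutoff_gt0 (Cr s sinC) (Cxy t tinC) st) nst.
  have [S' sS' lt] := uncross sC sinC tinC sS.
  by have := minC s t S' isT sS'; rewrite leqNgt lt.
have [xs ys] : x \in C :|: [set x; y] /\ y \in C :|: [set x; y].
  by rewrite !inE !eqxx !orbT.
have Cx v : v \in C -> v != x by apply: contraTneq => ->.
have Cy v : v \in C -> v != y by apply: contraTneq => ->.
have [C1|/subsetPn[c2 c2C]] := boolP (C \subset [set c]).
  exists c, x, y; split=> [| | |v cv].
  - by rewrite Cr.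
  - by rewrite clique ?Cx.
  - by rewrite clique ?Cy.
  have := nbrC c v cC cv; case: (boolP (v \in C)) => // /(subsetP C1).
  by rewrite in_set1 => /eqP vc; have := edge_neq cv; rewrite vc eqxx.
rewrite in_set1 => c2c; exfalso.
(* A nonroot [v] outside would separate together with [c]. Each side has a neighbour of [c], which
   is [c2] or adjacent to [c2], so [c2] would be on both sides. *)
have all v : v != r -> v \in C :|: [set x; y].
  move=> vr; apply: contraT => vC; have cv : c != v.
    by apply: contraNneq vC => <-; rewrite in_setU cC.
  have c2v : c2 != v by apply: contraNneq vC => <-; rewrite in_setU c2C.
  have ncv : ~~ edge c v.
    by apply: contra vC => cv_e; have := nbrC c v cC cv_e; rewrite !inE.
  have [S sS] := exists_sepset (Cr c cC) vr cv (cutoff_gt0 (Cr c cC) vr cv) ncv.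
  have key (Z : {set V}) z : z \in Z -> c \notin Z -> v \notin Z -> enclosed c v Z ->
      c2 \in Z.
    move=> zZ cZ vZ eZ; have [u uZ uc] := enclosed_edge zZ cZ vZ cv eZ.
    have [<-//|uc2] := eqVneq u c2.
    have uC : u \in C :|: [set x; y].
      by rewrite edgeC in uc; have := nbrC c u cC uc; rewrite !inE.
    have c2u : edge c2 u by rewrite clique // eq_sym.
    rewrite edgeC in c2u; move/enclosedP: eZ => /(_ u c2 uZ c2u).
    by rewrite (negPf c2c) (negPf c2v) !orbF.
  case/and5P: (sS) => _ _ _ /set0Pn[z zS] /and4P[_ cS vS eS].
  have [rD cD vD eD] := sepset_compl sS.
  have := key _ r rD cD vD eD; rewrite in_setC in_setU (key S z) //.
have rnbr v : edge r v -> (v == x) || (v == y).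
  move=> rv; have vr : v != r by rewrite eq_sym edge_neq.
  have := all v vr; rewrite !inE; case: (boolP (v \in C)) => // vC _.
  rewrite edgeC in rv; have := nbrC v r vC rv.
  by rewrite (negPf rC) !(eq_sym r) (negPf xr) (negPf yr).
have [rx ry] : edge r x /\ edge r y.
  have e := enclosed1 rnbr; have yx : y != x by rewrite eq_sym.
  split.
    by have [||u] := enclosed_edge (set11 r) _ _ xy e; rewrite in_set1 // => /eqP->.
  by have [||u] := enclosed_edge (set11 r) _ _ yx (enclosedC e); rewrite in_set1 // => /eqP->.
(* Every vertex of [C] is adjacent to [x], and [x] and [y] to the root, so the colour of [x] is
   connected to the root. *)
apply: (@col_disconnected (col x)) => u ur ux.
have rxc : connect (fun u v => [&& (u == r) || (col u == col x),
      (v == r) || (col v == col x) & edge u v]) r x.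
  by apply: connect1; rewrite !eqxx orbT.
have := all u ur; rewrite in_setU in_set2 => /or3P[uC|/eqP->//|/eqP uy].
  apply: connect_trans rxc (connect1 _).
  by rewrite ux eqxx !orbT edgeC clique ?Cx.
by apply: connect1; rewrite ux !eqxx orbT uy.
Qed.

Lemma cutoff_le_deg1 x y u : u \in comp x y -> cutoff x y + w x u <= deg x.
Proof.
move=> uK; rewrite /cutoff /deg [leqRHS](bigID (mem (comp x y))) /=.
rewrite [X in _ <= X + _](bigD1 u) //=.
rewrite (eq_bigl (fun v => v \notin comp x y)) => [|z]; last by rewrite in_setC.
by lia.
Qed.

(** Otherwise [z] and [z'] would cut off everything but the root, so [cutoff z z'] would be
    [deg z - w z r]. A further vertex [u] of the colour of [z'] leaves both the root and [z']
    reachable, so the equal value [cutoff z u] forces [w z z' = 0]. *)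
Lemma root_not_in_triangle z z' : z != z' -> edge r z -> edge r z' -> edge z z' ->
  ~ (forall v, edge r v -> (v == z) || (v == z')).
Proof.
move=> zz' rz rz' ezz' rnbr.
have [zr z'r] : z != r /\ z' != r by rewrite !(eq_sym _ r) !edge_neq.
have [u [ur uz uz' uc]] : exists u, [/\ u != r, u != z, u != z' & col u = col z'].
  suff /exists_inP[u /and3P[ur uz uz'] /eqP uc] :
      [exists u in [pred u | [&& u != r, u != z & u != z']], col u == col z'] by exists u.
  apply: contraT => /exists_inPn H; case: (@col_disconnected (col z')) => u ur uc.
  have ru : edge r u.
    have [->//|uz] := eqVneq u z; have [->//|uz'] := eqVneq u z'.
    by have := H u; rewrite inE ur uz uz' uc eqxx => /(_ isT).
  by apply: connect1; rewrite uc !eqxx orbT.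
have zu : z != u by rewrite eq_sym.
have eq_cut : cutoff z u = cutoff z z' by apply: cutoff_col.
have compE : comp z z' = [set r].
  apply/setP=> v; rewrite in_set1; apply/idP/eqP => [|->]; last exact: root_in_comp.
  rewrite inE => rv; apply/eqP; apply: (connect_inv (P := pred1 r)) rv (eqxx r).
  move=> a b /eqP-> /and3P[_ bzz' /rnbr]; rewrite !inE negb_or in bzz' *.
  by case/andP: bzz' => /negPf-> /negPf->.
have cutE : cutoff z z' + w z r = deg z.
  rewrite deg_root_edge // addnC /cutoff compE; congr (_ + _).
  by apply: eq_bigl => v; rewrite !inE.
have rK : r \in comp z u := root_in_comp _ _ _.
have z'K : z' \in comp z u.
  apply: (root_comp_step rK); apply/and3P; split=> //; first exact: set2_root.
  by rewrite !inE negb_or eq_sym zz' eq_sym uz'.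
have rz'_neq : r != z' by rewrite eq_sym.
have := cutoff_le_deg rz'_neq rK z'K; rewrite eq_cut cutE -[leqRHS]addn0 leq_add2l.
by rewrite leqn0 => /eqP w0; rewrite /edge_rel w0 in ezz'.
Qed.

Lemma connect_segment (e : rel V) (f : nat -> V) a b : a <= b ->
  (forall k, a <= k < b -> e (f k) (f k.+1)) -> connect e (f a) (f b).
Proof.
move=> /subnKC <-; elim: (b - a) => [|d IHd] H; first by rewrite addn0 connect0.
apply: connect_trans (IHd _) (connect1 _) => [k /andP[ak kd]|].
  by apply: H; rewrite ak addnS ltnS ltnW.
by rewrite addnS; apply: H; rewrite leq_addr addnS ltnSn.
Qed.

(** A sole neighbour of the root would be a cut vertex. Taking [t] to be the root yields a first
    neighbour. *)
Lemma root_neighbour t : exists2 z, z != t & edge r z.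
Proof.
suff /exists_inP[z zt rz] : [exists z in predC1 t, edge r z] by exists z.
apply: contraT => /exists_inPn noE.
have H v : v != t -> edge r v -> False by move=> vt; apply/negP/noE.
have [s sr st] : exists2 s, s != r & s != t.
  have [a ar ab] := has_col true; have [a' a'r a'b] := has_col false.
  have [at_|] := eqVneq a t; last by exists a.
  by exists a' => //; apply: contraTneq ab => E; rewrite at_ -E a'b.
have [tr|tr] := eqVneq t r.
  have [a ar ab] := has_col (~~ col s).
  have sa : s != a by apply/eqP=> E; move: ab; rewrite -E; case: (col s).
  have e : enclosed s a [set r].
    apply: enclosed1 => v rv; case: (H v) => //; rewrite tr.
    by rewrite eq_sym edge_neq.
  have [||u] := enclosed_edge (set11 r) _ _ sa e; rewrite ?in_set1 //.
  by move=> /eqP-> rs; case: (H s).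
have e : enclosed s t [set r].
  apply: enclosed1 => v rv; rewrite orbC; apply: contraT; rewrite negb_or => /andP[vt _].
  by case: (H v vt).
have [||u] := enclosed_edge (set11 r) _ _ st e; rewrite ?in_set1 //.
by move=> /eqP-> rs; case: (H s).
Qed.

(** * The Hamiltonian cycle *)

Section Degree2.

Variables c x y : V.
Hypotheses (cr : c != r) (xr : x != r) (yr : y != r) (xy : x != y).
Hypotheses (cx : edge c x) (cy : edge c y).
Hypothesis nbr : forall v, edge c v -> (v == x) || (v == y).

(** The pair [c], [v] is not adjacent, so it separates, and both sides contain a neighbour of [c]:
    one contains [x], the other [y]. *)
Lemma no_bypass v : v != r -> v != c -> v != x -> v != y ->
  ~ connect (without [set c; v]) x y.
Proof.
move=> vr vc vx vy; have cv : c != v by rewrite eq_sym.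
have ncv : ~~ edge c v by apply/negP => /nbr; rewrite (negPf vx) (negPf vy).
have [S sS] := exists_sepset cr vr cv (cutoff_gt0 cr vr cv) ncv.
case/and5P: (sS) => _ _ _ /set0Pn[z zS] /and4P[rS cS vS /[dup] eS /enclosedP nbrS].
have stable a b : connect (without [set c; v]) a b -> a \in S -> b \in S.
  move=> ab; apply: (connect_inv (P := mem S)) ab => {}a {}b aS /and3P[_ bcv ab].
  case/or3P: (nbrS a b aS ab) => // /eqP E; by rewrite E !inE eqxx ?orbT in bcv.
move=> xyc; have yxc : connect (without [set c; v]) y x by rewrite without_csym.
have [rD cD vD eD] := sepset_compl sS.
have [u uS uc] := enclosed_edge zS cS vS cv eS.
have [u' u'D u'c] := enclosed_edge rD cD vD cv eD.
rewrite in_setC in_setU negb_or in u'D; case/andP: u'D => /negP u'S _; apply: u'S.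
rewrite edgeC in uc; rewrite edgeC in u'c.
by case/orP: (nbr uc) => /eqP E; case/orP: (nbr u'c) => /eqP ->;
  rewrite E in uS; eauto.
Qed.

Variable p : seq V.
Hypothesis path_p : path (without [set c]) x p.
Hypothesis last_p : last x p = y.
Hypothesis uniq_p : uniq (x :: p).

Let f k := nth r (x :: p) k.

Let f_edge k : k < size p -> without [set c] (f k) (f k.+1).
Proof. by move=> kp; have /pathP := path_p; apply. Qed.

Let f_last : f (size p) = y.
Proof. exact: etrans (nth_last r (x :: p)) last_p. Qed.

Let f_inj i j : i <= size p -> j <= size p -> f i = f j -> i = j.
Proof. by move=> ip jp /eqP; rewrite nth_uniq //= => /eqP. Qed.

Let f_c k : k <= size p -> f k != c.
Proof.
case: k => [_|k kp]; first by rewrite eq_sym edge_neq.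
by have /and3P[_] := f_edge kp; rewrite in_set1.
Qed.

Let f_index v : v \in x :: p -> exists2 k, k <= size p & v = f k.
Proof.
move=> vp; exists (index v (x :: p)); last by rewrite /f nth_index.
by rewrite -ltnS -[(size p).+1]/(size (x :: p)) index_mem.
Qed.

(** Together with the parts of the path before [f a] and after [f b], such a connection would bypass
    [f k]. *)
Lemma no_jump a k b : a < k < b -> b <= size p -> f k != r ->
  ~ connect (without [set c; f k]) (f a) (f b).
Proof.
case/andP=> ak kb bp fkr ab.
have kp : k <= size p by nat_lia.
have neq j : j <= size p -> j != k -> f j \notin [set c; f k].
  move=> jp jk; rewrite !inE negb_or f_c //=.
  by apply: contraNneq jk => /(f_inj jp kp)->.
have seg i j : i <= j -> j <= size p -> (forall l, i <= l <= j -> l != k) ->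
    connect (without [set c; f k]) (f i) (f j).
  move=> ij jp ne; apply: connect_segment => // l /andP[il lj].
  have /and3P[_ _ e] := f_edge (leq_trans lj jp).
  by apply/and3P; split=> //; apply: neq; try (apply: ne); nat_lia.
apply: (@no_bypass (f k)) => //.
- exact: f_c.
- by apply/eqP=> /(@f_inj k 0 kp isT); nat_lia.
- by rewrite -f_last; apply/eqP=> /(f_inj kp (leqnn _)); nat_lia.
have xa : connect (without [set c; f k]) x (f a).
  by apply: (seg 0 a) => [||l]; nat_lia.
have yb : connect (without [set c; f k]) (f b) y.
  by rewrite -f_last; apply: seg => [||l]; nat_lia.
exact: connect_trans xa (connect_trans ab yb).
Qed.

(** The path [p] itself would bypass a vertex that it misses. *)
Lemma in_path v : v != r -> v != c -> v \in x :: p.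
Proof.
move=> vr vc; apply: contraT => vp.
have vx : v != x by apply: contraNneq vp => ->; rewrite mem_head.
have vy : v != y by apply: contraNneq vp => ->; rewrite -last_p mem_last.
case: (no_bypass vr vc vx vy); rewrite -[x]/(f 0) -f_last; apply: connect_segment => // k kp.
have /and3P[fk fk1 e] := f_edge kp.
apply/and3P; split=> //; rewrite !inE negb_or f_c ?(ltnW kp) //=;
  by apply: contraNneq vp => <-; rewrite mem_nth // ltnS ?(ltnW kp).
Qed.

Lemma root_path_neighbour v : edge r v -> exists2 k, k <= size p & v = f k.
Proof.
move=> rv; apply: f_index; apply: in_path; first by rewrite eq_sym edge_neq.
apply: contraTneq rv => ->; rewrite edgeC; apply/negP=> /nbr.
by rewrite !(eq_sym r) (negPf xr) (negPf yr).
Qed.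

(** For a root off the path, any two of its neighbours are consecutive on it, as otherwise the root
    would provide a jump. It has at least two, hence exactly two, and they form a triangle with
    it. *)
Lemma root_in_path : r \in x :: p.
Proof.
apply: contraT => rp.
have fr k : k <= size p -> f k != r.
  by move=> kp; apply: contraNneq rp => <-; rewrite mem_nth.
have consecutive i j : i < j -> j <= size p -> edge r (f i) -> edge r (f j) -> j = i.+1.
  move=> ij jp ri rj; apply/eqP; apply: contraT => nj.
  have ip : i.+1 <= size p by nat_lia.
  have [] := @no_jump i i.+1 j _ jp (fr _ ip); first by nat_lia.
  have rS : r \notin [set c; f i.+1] by rewrite !inE negb_or !(eq_sym r) cr fr.
  have nS l : l <= size p -> l != i.+1 -> f l \notin [set c; f i.+1].
    move=> lp li; rewrite !inE negb_or f_c //=.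
    by apply: contraNneq li => /(f_inj lp ip)->.
  rewrite edgeC in ri; apply: (connect_trans (connect1 _) (connect1 _)); last first.
  - by apply/and3P; split; [exact: rS | exact: nS | exact: rj].
  by apply/and3P; split=> //; apply: nS; nat_lia.
have [z _ rz] := root_neighbour r; have [z' z'z rz'] := root_neighbour z.
have [i [ip ri ri1]] : exists i, [/\ i < size p, edge r (f i) & edge r (f i.+1)].
  have [i ip zE] := root_path_neighbour rz; have [j jp z'E] := root_path_neighbour rz'.
  have ij : i != j by apply: contraNneq z'z => ij; rewrite z'E zE ij.
  rewrite zE in rz; rewrite z'E in rz'.
  have [lt|lt] : i < j \/ j < i by nat_lia.
    by have E := consecutive i j lt jp rz rz'; exists i; rewrite -E; split=> //; nat_lia.
  by have E := consecutive j i lt ip rz' rz; exists j; rewrite -E; split=> //; nat_lia.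
have neq : f i != f i.+1.
  by apply/eqP=> /(f_inj (ltnW ip) ip); nat_lia.
have /and3P[_ _ e] := f_edge ip.
case: (root_not_in_triangle neq ri ri1 e).
move=> v /[dup] /root_path_neighbour[k kp ->] rk.
have [lt|[->|lt]] : k < i \/ k = i \/ i < k by nat_lia.
- by have := consecutive k i.+1 _ _ rk ri1; nat_lia.
- by rewrite eqxx.
by rewrite (consecutive i k lt kp ri rk) eqxx orbT.
Qed.

(** By [no_jump] a chord can skip only the root. It then closes a triangle at the root, which has no
    further neighbours for the same reason. *)
Lemma path_chordless a b : a < b -> b <= size p -> edge (f a) (f b) -> b = a.+1.
Proof.
have chord i j k : i < k < j -> j <= size p -> f k != r -> ~~ edge (f i) (f j).
  move=> ikj jp fkr; apply/negP=> e; apply: (no_jump ikj jp fkr).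
  have kp : k <= size p by nat_lia.
  have nS l : l <= size p -> l != k -> f l \notin [set c; f k].
    move=> lp lk; rewrite !inE negb_or f_c //=.
    by apply: contraNneq lk => /(f_inj lp kp)->.
  by apply: connect1; apply/and3P; split=> //; apply: nS; nat_lia.
move=> ab bp e; apply/eqP; apply: contraT => nb.
have [m mp mr] := f_index root_in_path.
have nr k : k <= size p -> k != m -> f k != r.
  by move=> kp; rewrite mr; apply: contraNneq => /(f_inj kp mp)->.
have [ma|ma] := eqVneq m a.+1; last first.
  by have := chord a b a.+1; rewrite e nr 1?eq_sym //; nat_lia.
have [ba|ba] := eqVneq b a.+2; last first.
  by have := chord a b a.+2; rewrite e nr ?ma //; nat_lia.
rewrite ba ma in mr bp e *.
have neq : f a != f a.+2 by apply/eqP=> /f_inj; nat_lia.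
have [ra ra2] : edge r (f a) /\ edge r (f a.+2).
  have /and3P[_ _ e1] := f_edge (ltnW bp); have /and3P[_ _ e2] := f_edge bp.
  by rewrite mr edgeC.
case: (root_not_in_triangle neq ra ra2 e).
move=> v /[dup] /root_path_neighbour[k kp ->]; rewrite mr => rk.
have [lt|[E|[->|[->|lt]]]] : k < a \/ k = a.+1 \/ k = a \/ k = a.+2 \/ a.+2 < k by nat_lia.
- by have := chord k a.+1 a; rewrite edgeC rk nr ?ma //; nat_lia.
- by have := edge_neq rk; rewrite E eqxx.
- by rewrite eqxx.
- by rewrite eqxx orbT.
by have := chord a.+1 k a.+2; rewrite rk nr ?ma //; nat_lia.
Qed.

Lemma degree2_cycle : [/\ 2 < size (c :: x :: p), uniq (c :: x :: p),
  forall v, v \in c :: x :: p, path.cycle edge (c :: x :: p) &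
  forall u v, edge u v ->
    (v == next (c :: x :: p) u) || (u == next (c :: x :: p) v)].
Proof.
have cp : c \notin x :: p.
  by apply/negP=> /f_index[k kp cE]; have := f_c kp; rewrite -cE eqxx.
have uq : uniq (c :: x :: p) by rewrite cons_uniq cp.
have all v : v \in c :: x :: p.
  rewrite in_cons; have [//|vc] := eqVneq v c; have [->|vr] := eqVneq v r.
    by rewrite root_in_path.
  by rewrite in_path.
have nextf k : k < size p -> next (c :: x :: p) (f k) = f k.+1.
  move=> kp; rewrite next_nth all [index _ _]/=.
  have fkc : (c == f k) = false by rewrite eq_sym; apply/negbTE/f_c; nat_lia.
  rewrite fkc -[nth _ _ _]/(nth c (x :: p) (index (f k) (x :: p)).+1).
  rewrite index_uniq //= ?ltnS ?(ltnW kp) // (set_nth_default r) //.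
have nextc : next (c :: x :: p) c = x by rewrite next_nth all /= eqxx.
have nexty : next (c :: x :: p) y = c.
  rewrite next_nth all -f_last [index _ _]/=.
  have fkc : (c == f (size p)) = false by rewrite eq_sym; apply/negbTE/f_c.
  (* The position after [y] is out of range, so [nth] falls back on its default [c], which closes
     the cycle. *)
  rewrite fkc -[nth _ _ _]/(nth c (x :: p) (index (f (size p)) (x :: p)).+1).
  by rewrite index_uniq //= nth_default.
split=> //.
- rewrite /= !ltnS lt0n size_eq0; apply: contraNneq xy => p0.
  by move: last_p; rewrite p0 /= => ->.
- rewrite /= cx rcons_path last_p edgeC cy andbT.
  by apply: sub_path path_p => a b /and3P[].
have main u v : u \in x :: p -> v \in x :: p -> edge u v ->
    (v == next (c :: x :: p) u) || (u == next (c :: x :: p) v).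
  move=> /f_index[i ip ->] /f_index[j jp ->] e.
  have [lt|[E|lt]] : i < j \/ i = j \/ j < i by nat_lia.
  - have E := path_chordless lt jp e; rewrite E in jp *.
    by rewrite nextf // eqxx.
  - by have := edge_neq e; rewrite E eqxx.
  rewrite edgeC in e; have E := path_chordless lt ip e; rewrite E in ip *.
  by rewrite (nextf j) // eqxx orbT.
move=> u v e; have := all u; have := all v; rewrite ![_ \in c :: _]in_cons.
case/orP=> [/eqP vc|vp] /orP[/eqP uc|up]; last exact: main.
- by have := edge_neq e; rewrite uc vc eqxx.
- move: e; rewrite vc edgeC => /nbr/orP[] /eqP->; first by rewrite nextc eqxx orbT.
  by rewrite nexty eqxx.
move: e; rewrite uc => /nbr/orP[] /eqP->; first by rewrite nextc eqxx.
by rewrite nexty eqxx orbT.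
Qed.

End Degree2.

Lemma root_cycle : exists t, [/\ 1 < size t, uniq (r :: t),
  forall v, v \in r :: t, path.cycle edge (r :: t) &
  forall u v, edge u v -> (v == next (r :: t) u) || (u == next (r :: t) v)].
Proof.
have [c [x [y [[cr xr yr xy] cx cy nbr]]]] := exists_degree2.
have [xc yc] : x != c /\ y != c by rewrite !(eq_sym _ c) !edge_neq.
have /connectP[p0 p0P lastp] := conn2 xc yc.
case/shortenP: p0P lastp => p path_p uniq_p _ /esym last_p.
have [sz uq all cyc nxt] := degree2_cycle cr xr yr xy cx cy nbr path_p last_p uniq_p.
have [i t rotE] := rot_to (all r).
exists t; rewrite -rotE; split.
- by rewrite -ltnS -[(size t).+1]/(size (r :: t)) -rotE size_rot.
- by rewrite rot_uniq.
- by move=> v; rewrite mem_rot.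
- by rewrite rot_cycle.
by move=> u v /nxt; rewrite !next_rot.
Qed.

(** * Weights on the cycle *)

Section Weights.

Variable t : seq V.
Hypotheses (t_gt1 : 1 < size t) (uniq_t : uniq (r :: t)).
Hypothesis all_t : forall v, v \in r :: t.
Hypothesis cycle_t : path.cycle edge (r :: t).
Hypothesis edge_t : forall u v, edge u v -> (v == next (r :: t) u) || (u == next (r :: t) v).

(* The default value of [nth] makes [g (size t).+1 = r], closing up the cycle. *)
Let g k := nth r (r :: t) k.

Let g_last : g (size t).+1 = r.
Proof. by rewrite /g /= nth_default. Qed.

Let g_inj i j : i <= size t -> j <= size t -> g i = g j -> i = j.
Proof. by move=> ip jp /eqP; rewrite nth_uniq //= => /eqP. Qed.

Let g_root k : 0 < k <= size t -> g k != r.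
Proof. by case/andP=> k0 kt; apply/eqP=> /(@g_inj k 0 kt isT); nat_lia. Qed.

Let g_index v : v != r -> exists2 k, 0 < k <= size t & v = g k.
Proof.
move=> vr; exists (index v (r :: t)); last by rewrite /g nth_index.
apply/andP; split; first by rewrite /= eq_sym (negPf vr).
by rewrite -ltnS -[(size t).+1]/(size (r :: t)) index_mem.
Qed.

Let g_next k : k <= size t -> next (r :: t) (g k) = g k.+1.
Proof.
move=> kt; rewrite next_nth all_t.
by rewrite -[nth r t _]/(nth r (r :: t) (index (g k) (r :: t)).+1) index_uniq.
Qed.

Let g_edge k : k <= size t -> edge (g k) (g k.+1).
Proof. by move=> kt; rewrite -g_next //; apply: next_cycle. Qed.

Let g_edgeP i j : i <= size t -> j <= size t -> edge (g i) (g j) ->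
  g j = g i.+1 \/ g i = g j.+1.
Proof. by move=> it jt /edge_t; rewrite !g_next // => /orP[]/eqP; [left|right]. Qed.

Let g_neq k : 0 < k <= size t -> g k.-1 != g k.+1.
Proof.
case: k => // k /andP[_ kt]; have [->|kE] := eqVneq k.+1 (size t).
  by rewrite g_last g_root //; nat_lia.
by apply/eqP=> /g_inj; nat_lia.
Qed.

Lemma deg_cycle k : 0 < k <= size t ->
  deg (g k) = w (g k) (g k.-1) + w (g k) (g k.+1).
Proof.
move=> kt; rewrite /deg (bigD1 (g k.-1)) //= (bigD1 (g k.+1)) /=; last first.
  by rewrite eq_sym g_neq.
rewrite big1 ?addn0 // => v /andP[v1 v2]; apply: not_edge; apply/negP=> kv.
have kt' : k <= size t by nat_lia.
(* The root is both [g 0] and [g (size t).+1], so it is treated apart from the other vertices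
   [g j]. *)
have [vr|vr] := eqVneq v r.
  have kv0 : edge (g k) (g 0) by rewrite -[g 0]/r -vr.
  have [E|E] := g_edgeP kt' (leq0n _) kv0; first by rewrite -E vr eqxx in v2.
  have kk : k = 1 by apply: (g_inj _ _ E); nat_lia.
  by rewrite kk vr eqxx in v1.
have [j jt vE] := g_index vr; rewrite vE in kv v1 v2.
have jt' : j <= size t by nat_lia.
have [E|E] := g_edgeP kt' jt' kv; first by rewrite E eqxx in v2.
have [jE|jE] := eqVneq j (size t).
  by have := @g_root k kt; rewrite E jE g_last eqxx.
have kE : k = j.+1 by apply: (g_inj _ _ E); nat_lia.
by rewrite kE eqxx in v1.
Qed.

(** The whole degree of [u] goes to [v] and [v']. With [v] still joined to the root, [v'] must be
    cut off, since the cutoff is positive. *)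
Lemma cutoff_neighbour u z v v' : u != r -> z != r -> u != z -> v != v' ->
  deg u = w u v + w u v' -> v \in comp u z -> cutoff u z = w u v'.
Proof.
move=> ur zr uz vv' degE vK; apply/eqP; rewrite eqn_leq; apply/andP; split.
  by have := cutoff_le_deg1 vK; rewrite degE; nat_lia.
apply: le_cutoff; apply/negP=> v'K; have := cutoff_le_deg vv' vK v'K.
by have := cutoff_gt0 ur zr uz; rewrite degE; nat_lia.
Qed.

(** The arc of the cycle from the root up to [g a.-1] avoids both deleted vertices; when [b < a],
    the arc from [g a.+1] on to the root does. *)
Lemma cutoff_cycle_lt a b : 0 < a -> a < b <= size t ->
  cutoff (g a) (g b) = w (g a) (g a.+1).
Proof.
move=> a0 ab; have at_ : 0 < a <= size t by nat_lia.
have nS k : k < a -> g k \notin [set g a; g b].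
  by move=> ka; rewrite !inE negb_or; apply/andP; split; apply/eqP=> /g_inj; nat_lia.
have aK : g a.-1 \in comp (g a) (g b).
  rewrite inE -[X in connect _ X _]/(g 0); apply: connect_segment => // k ka.
  by apply/and3P; split; [apply: nS | apply: nS | apply: g_edge]; nat_lia.
have neq : g a != g b by apply/eqP=> /g_inj; nat_lia.
have bt : 0 < b <= size t by nat_lia.
by apply: cutoff_neighbour aK; rewrite ?g_root ?g_neq ?deg_cycle.
Qed.

Lemma cutoff_cycle_gt a b : 0 < b -> b < a <= size t ->
  cutoff (g a) (g b) = w (g a) (g a.-1).
Proof.
move=> b0 ba; have at_ : 0 < a <= size t by nat_lia.
have nS k : a < k <= (size t).+1 -> g k \notin [set g a; g b].
  move=> ka; have [->|kt] := eqVneq k (size t).+1.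
    by rewrite g_last set2_root // g_root; nat_lia.
  by rewrite !inE negb_or; apply/andP; split; apply/eqP=> /g_inj; nat_lia.
have aK : g a.+1 \in comp (g a) (g b).
  rewrite inE (without_csym w_sym).
  have : connect (without [set g a; g b]) (g a.+1) (g (size t).+1).
    apply: connect_segment => [|k ka]; first by nat_lia.
    by apply/and3P; split; [apply: nS | apply: nS | apply: g_edge]; nat_lia.
  by rewrite g_last.
have neq : g a != g b by apply/eqP=> /g_inj; nat_lia.
have bt : 0 < b <= size t by nat_lia.
by apply: cutoff_neighbour aK; rewrite ?g_root // 1?eq_sym ?g_neq // deg_cycle // addnC.
Qed.

(* Some vertex of the colour of [u] is cut off from the root within its own
   colour, so it has vertices of the other colour on both sides. *)
Lemma deg_cutoff u z : u != r -> z != r -> col u != col z -> deg u = (cutoff u z).*2.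
Proof.
move=> ur zr uz.
pose R : rel V := fun u' v => [&& (u' == r) || (col u' == col u),
  (v == r) || (col v == col u) & edge u' v].
have /exists_inP[u' u'r /andP[/eqP u'c nR]] :
    [exists u' in predC1 r, (col u' == col u) && ~~ connect R r u'].
  apply: contraT => /exists_inPn H; case: (@col_disconnected (col u)) => v vr vc.
  by have := H v vr; rewrite vc eqxx negbK.
have [a at_ u'E] := g_index u'r; rewrite {u'r}u'E in u'c nR.
have Rsym : connect_sym R.
  by apply: sym_connect_sym => v v'; rewrite /R edgeC andbCA.
have Rseg i j : i <= j -> j <= (size t).+1 ->
    (forall k, i <= k <= j -> (g k == r) || (col (g k) == col u)) -> connect R (g i) (g j).
  move=> ij jt inR; apply: connect_segment => // k kij.
  by apply/and3P; split; [apply: inR; nat_lia | apply: inR; nat_lia | apply: g_edge; nat_lia].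
have [b [b0 ba bc]] : exists b, [/\ 0 < b, b < a & col (g b) != col u].
  suff /existsP[b /andP[b0 bc]] : [exists b : 'I_a, (0 < b) && (col (g b) != col u)].
    by exists b; split.
  apply: contraT => /existsPn H; case/negP: nR; apply: (Rseg 0 a); try nat_lia.
  move=> k /andP[_]; rewrite leq_eqVlt => /orP[/eqP->|ka]; first by rewrite u'c eqxx orbT.
  have := H (Ordinal ka); rewrite /= negb_and negbK -eqn0Ngt.
  by case/orP=> [/eqP->|->]; rewrite ?orbT // [g 0]/= eqxx.
have [d [da dt dc]] : exists d, [/\ a < d, d <= size t & col (g d) != col u].
  suff /existsP[d /andP[d0 dc]] : [exists d : 'I_(size t).+1, (a < d) && (col (g d) != col u)].
    by exists d; split=> //; rewrite -ltnS.
  apply: contraT => /existsPn H; case/negP: nR; rewrite Rsym -[X in connect _ _ X]g_last.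
  apply: Rseg; try nat_lia; move=> k /andP[ak kt].
  have [->|kE] := eqVneq k (size t).+1; first by rewrite g_last eqxx.
  have [->|ka] := eqVneq k a; first by rewrite u'c eqxx orbT.
  have kt' : k < (size t).+1 by nat_lia.
  have := H (Ordinal kt'); rewrite /= negb_and negbK ltn_neqAle ak eq_sym ka /=.
  by move=> ->; rewrite orbT.
have colz v : col v != col u -> col v = col z by case: (col v) (col u) (col z) uz => [] [] [].
have cutE e : 0 < e <= size t -> e != a -> col (g e) != col u ->
    cutoff (g a) (g e) = cutoff u z.
  move=> et ea ec; apply: cutoff_col; rewrite ?g_root ?(colz _ ec) //.
    by apply: contraNneq ea => /g_inj->; nat_lia.
  by apply: contraNneq uz => ->.
(* With [b] before and [d] after [a], each of the two edges at [g a] carries a mixed cutoff, equal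
   to [cutoff u z]. *)
rewrite -(deg_col _ ur u'c) ?g_root // deg_cycle // -addnn; congr (_ + _).
  by rewrite -(@cutoff_cycle_gt a b) ?cutE //; nat_lia.
by rewrite -(@cutoff_cycle_lt a d) ?cutE //; nat_lia.
Qed.

(** The two edges at any nonroot vertex sum to twice the weight [a] of a fixed mixed edge, so weight
    [a] propagates around the cycle. *)
Lemma cycle_weights : exists2 a, 0 < a & forall u v,
  w u v = if (v == next (r :: t) u) || (u == next (r :: t) v) then a else 0.
Proof.
have [x xr xb] := has_col true; have [y yr yb] := has_col false.
(* Deleting the root leaves a connected graph with both colours, so some edge between nonroot
   vertices is mixed. *)
have /exists_inP[u /andP[ur ub] /existsP[v /and3P[vr vb uv]]] :
    [exists u in [pred u | (u != r) && col u], exists v, [&& v != r, ~~ col v & edge u v]].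
  apply: contraT => /exists_inPn H.
  have := connect_inv (P := fun u => (u != r) && col u) _ (conn2 xr yr).
  rewrite xr xb yb andbF; apply=> // u v /andP[ur ub] /and3P[_ vr uv].
  rewrite in_set1 in vr; rewrite vr; apply: contraT => vb.
  have := H u; rewrite inE ur ub => /(_ isT); rewrite negb_exists => /forallP/(_ v).
  by rewrite vr vb uv.
have uvc : col u != col v by rewrite ub (negPf vb).
have vuc : col v != col u by rewrite eq_sym.
have [cut_uv cut_vu] : cutoff u v = w u v /\ cutoff v u = w v u.
  have [i it uE] := g_index ur; have [j jt vE] := g_index vr.
  have nr k : k <= size t -> g k.+1 != r -> k < size t.
    by move=> kt; apply: contraNltn => tk; have -> : k = size t by [nat_lia]; rewrite g_last.
  have [it' jt'] : i <= size t /\ j <= size t by nat_lia.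
  have euv := uv; rewrite uE vE in euv; rewrite uE vE.
  have [E|E] := g_edgeP it' jt' euv.
    have ilt : i < size t by apply: nr; [nat_lia|rewrite -E -vE].
    have ji : j = i.+1 by apply: (g_inj _ _ E); nat_lia.
    by rewrite ji cutoff_cycle_lt ?cutoff_cycle_gt //; nat_lia.
  have jlt : j < size t by apply: nr; [nat_lia|rewrite -E -uE].
  have ij : i = j.+1 by apply: (g_inj _ _ E); nat_lia.
  by rewrite ij cutoff_cycle_gt ?cutoff_cycle_lt //; nat_lia.
pose a := w u v.
have degE z : z != r -> deg z = a.*2.
  move=> zr; have [zu|zu] := eqVneq (col z) (col u).
    by rewrite (deg_col zr ur zu) (deg_cutoff ur vr uvc) cut_uv.
  have zv : col z = col v by move: zu uvc; case: (col z); case: (col u); case: (col v).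
  by rewrite (deg_col zr vr zv) (deg_cutoff vr ur vuc) cut_vu w_sym.
pose h k := w (g k) (g k.+1).
have hE k : 0 < k <= size t -> h k.-1 + h k = a.*2.
  case: k => // k kt; rewrite -(degE (g k.+1)) ?g_root // deg_cycle // /h.
  by congr (_ + _); apply: w_sym.
have step k : k < size t -> (h k == a) = (h k.+1 == a).
  by move=> kt; have := hE k.+1; rewrite /= kt => /(_ isT); rewrite -addnn; nat_lia.
have h0 k : k <= size t -> (h k == a) = (h 0 == a).
  by elim: k => // k IHk kt; rewrite -step // IHk // ltnW.
have hk k : k <= size t -> h k = a.
  move=> kt; apply/eqP; rewrite h0 //.
  have [i it uE] := g_index ur; have [j jt vE] := g_index vr.
  have [it' jt'] : i <= size t /\ j <= size t by nat_lia.
  have euv := uv; rewrite uE vE in euv.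
  have [E|E] := g_edgeP it' jt' euv.
    by rewrite -(h0 i) /h // -E -uE -vE.
  by rewrite -(h0 j) /h // -E -uE -vE w_sym.
have wn z z' : z' = next (r :: t) z -> w z z' = a.
  have zlt : index z (r :: t) <= size t.
    by rewrite -ltnS -[(size t).+1]/(size (r :: t)) index_mem.
  by move->; rewrite -(nth_index r (all_t z)) g_next // -(hk _ zlt).
exists a => // z z'; case: ifP => [/orP[] /eqP E|zz']; first exact: wn.
  by rewrite w_sym; apply: wn.
by apply: not_edge; apply/negP=> /edge_t; rewrite zz'.
Qed.

End Weights.

Theorem two_connected_weighted_cycle : exists2 a, 0 < a & exists c : seq V,
  [/\ 2 < size c, uniq c, forall v, v \in c
    & forall u v, w u v = if (v == next c u) || (u == next c v) then a else 0].
Proof.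
have [t [sz uq all cyc nxt]] := root_cycle.
have [a a0 wE] := cycle_weights sz uq all cyc nxt.
by exists a => //; exists (r :: t).
Qed.

End TwoConnected.

(** * Comparing root weights; first entries of walks *)

Lemma root_wt_le (V : finType) (r : V) w (S S' : {set V}) x :
    (forall v, v \in root_comp r w S -> edge_rel w x v -> v \in root_comp r w S') ->
  root_wt r w S x <= root_wt r w S' x.
Proof.
move=> H; rewrite /root_wt big_mkcond [leqRHS]big_mkcond; apply: leq_sum => v _.
case: ifP => // vS; case: ifP => // /negP nS'; rewrite leqNgt; apply/negP=> xv.
exact/nS'/H.
Qed.

Lemma root_wt_lt (V : finType) (r : V) w (S S' : {set V}) x v :
    S \subset S' -> v \in root_comp r w S -> v \notin root_comp r w S' -> edge_rel w x v ->
  root_wt r w S' x < root_wt r w S x.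
Proof.
move=> sS vS vS' xv; rewrite /root_wt [leqRHS](bigID (mem (root_comp r w S'))) /=.
rewrite [X in _ < X + _](eq_bigl (mem (root_comp r w S'))) => [|u]; last first.
  by rewrite andb_idl // => /(subsetP (root_compS _ _ sS)).
by rewrite -addn1 leq_add2l (bigD1 v) ?vS //= (leq_trans xv) ?leq_addr.
Qed.

(** Take for [h] the first vertex of [W] on a walk from [u] to [v]; the walk up to it meets no other
    vertex of [W]. *)
Lemma first_hit (V : finType) (w : V -> V -> nat) (W : {set V}) u v :
    connect (edge_rel w) u v -> v \in W ->
  exists2 h, h \in W & (u \in W -> h = u) /\
    forall x, x \in W -> x != h -> connect (without w [set x]) u h.
Proof.
move=> /connectP[p + ->]; elim: p u => [|y p IHp] u /=.
  by move=> _ uW; exists u => //; split=> // x _ _; apply: connect0.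
case/andP=> uy yp lastW; have [uW|uW] := boolP (u \in W).
  by exists u => //; split=> // x _ _; apply: connect0.
have [h hW [yh H]] := IHp y yp lastW; exists h => //; split=> [|x xW xh].
  by [].
have uyx : y != x -> without w [set x] u y.
  by move=> yx; rewrite /without !in_set1 yx uy !andbT; apply: contraNneq uW => ->.
have [yW|yW] := boolP (y \in W).
  by rewrite yh //; apply/connect1/uyx; rewrite -(yh yW) eq_sym.
by apply: connect_trans (connect1 (uyx _)) (H x xW xh); apply: contraNneq yW => ->.
Qed.

(** * From bad mixed pairs to 2-connectedness *)

Section Coloured.

Variables (T : finType) (G : rooted_graph T) (ty : T -> bool).
Notation w := (wt G).
Notation comp := (root_comp None w).
Hypothesis inv : forall x y b, ty x = ty y ->
  parking G (b \o tperm x y) <-> parking G b.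

(** If each end stays reachable when the other is deleted, then deleting both loses the edge between
    them from both root weights, so the pair is bad. *)
Lemma edge_cut x y : edge_rel w (Some x) (Some y) -> ~~ bad G x y ->
  (Some y \notin comp [set Some x]) || (Some x \notin comp [set Some y]).
Proof.
move=> xy; rewrite -negb_and; apply: contra => /andP[yK xK]; apply/andP; split.
  apply: (root_wt_lt (v := Some y)) => //; first exact: subsetUl.
  apply/negP=> /root_comp_notin; rewrite !inE eqxx orbT => H; apply: notF; exact: H.
apply: (root_wt_lt (v := Some x)); rewrite // 1?edge_sym //.
- exact: subsetUl.
- apply/negP=> /root_comp_notin; rewrite !inE eqxx orbT => H; apply: notF; exact: H.
exact: wt_sym.
Qed.

Section MixedBad.

Hypothesis mixed_bad : forall x y, ty x != ty y -> bad G x y.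
Hypothesis has_ty : forall b, exists x, ty x = b.

Lemma mixed_rwt x y : ty x != ty y -> rwt2 G x y < rdeg G x.
Proof. by move/mixed_bad => /andP[]. Qed.

(** If [x] already cuts off [y], deleting [y] as well changes nothing for [x], so the pair is not
    bad and hence not mixed. *)
Lemma cut_off_same x y : y != x -> Some y \notin comp [set Some x] -> ty y = ty x.
Proof.
move=> yx yK; apply/eqP; apply: contraT; rewrite eq_sym => /mixed_rwt.
rewrite ltnNge => /negP[]; apply: root_wt_le => v vK _.
pose P v := (v \in comp [set Some x]) && (v \in comp [set Some x; Some y]).
suff /andP[] : P v by [].
move: vK; rewrite inE => /(connect_inv (P := P)); apply.
  move=> u {}v /andP[uK uK2] uv; have vK := root_comp_step uK uv; rewrite /P vK /=.
  apply: (root_comp_step uK2); case/and3P: uv => ux vx uv; apply/and3P; split=> //.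
    by apply: root_comp_notin uK2; rewrite !inE.
  by rewrite in_setU negb_or vx in_set1; apply: contraNneq yK => <-.
by rewrite /P !root_in_comp.
Qed.

(** Let [x] cut off [y], and take [z] of the other type. Any walk from the root through [y] enters
    and leaves through [x], so deleting [y] besides [z] does not lower the root weight of [z],
    although this mixed pair is bad. *)
Lemma root_comp1 x y : y != x -> Some y \in comp [set Some x].
Proof.
move=> yx; apply: contraT => yK; have yx_ty := cut_off_same yx yK.
have [z zx] := has_ty (~~ ty x).
have zty : ty z != ty x by rewrite zx; case: (ty x).
have zx_neq : z != x by apply: contraNneq zty => ->.
have zy_neq : Some z != Some y by apply: contraNneq zty => -[->]; rewrite yx_ty.
have zK : Some z \in comp [set Some x].
  by apply: contraT => /(cut_off_same zx_neq) E; rewrite E eqxx in zty.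
have := mixed_rwt (x := z) (y := y); rewrite yx_ty => /(_ zty).
rewrite ltnNge => /negP[]; apply: root_wt_le => u uK zu.
pose K := comp [set Some z; Some y].
pose B v := (v == Some x) || (v \in comp [set Some x]).
have Bout v v' : B v -> edge_rel w v v' -> ~~ B v' -> v = Some x.
  case/orP=> [/eqP//|vK] vv'; have := root_comp_out (None_notin_Some [set x]).
  rewrite imset_set1 => /(_ _ _ _ vK vv'); rewrite in_setU in_set1 orbC.
  by rewrite /B => ->.
have yB : ~~ B (Some y) by rewrite /B negb_or yK andbT; apply: contraNneq yx => -[->].
(* Vertices behind [x] are represented by [x], so detours beyond [x] are cut short. *)
pose P v := if B v then v \in K else Some x \in K.
have : P u.
  move: uK; rewrite inE => /(connect_inv (P := P)); apply; last first.
    by rewrite /P /B root_in_comp orbT root_in_comp.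
  move=> v v'; rewrite /P => + /and3P[vz v'z vv'].
  have [Bv|nBv] := boolP (B v); have [Bv'|nBv'] := boolP (B v') => // vK.
  - apply: (root_comp_step vK); apply/and3P; split=> //.
      by apply: root_comp_notin vK; rewrite !inE.
    by rewrite in_setU negb_or v'z in_set1; apply: contraNneq yB => <-.
  - by rewrite -(Bout _ _ Bv vv' nBv').
  by rewrite (Bout v' v) // edge_sym //; apply: wt_sym.
have Bu : B u.
  have := root_comp_out (None_notin_Some [set x]).
  by rewrite imset_set1 => /(_ _ _ _ zK zu); rewrite in_setU in_set1 orbC.
by rewrite /P Bu.
Qed.

(** If [x] and [y] lay in different components of the graph without the root, deleting [y] would not
    lower the root weight of [x]. *)
Lemma connect_without_root x y : ty x != ty y ->
  connect (without w [set None]) (Some x) (Some y).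
Proof.
move=> xy; apply: contraT => nC.
pose C v := connect (without w [set None]) (Some x) v.
have := mixed_rwt xy; rewrite ltnNge => /negP[]; apply: root_wt_le => u uK xu.
pose K := comp [set Some x; Some y].
pose P v := (v == None) || C v ==> (v \in K).
have : P u.
  move: uK; rewrite inE => /(connect_inv (P := P)); apply; last first.
    by rewrite /P root_in_comp implybT.
  move=> v v' Pv /and3P[vx v'x vv']; apply/implyP; case: v' v'x vv' => [v'|] v'x vv'.
    rewrite /= => Cv'; have vK : v \in K.
      apply: (implyP Pv); case: v vx vv' {Pv} => // v vx vv'.
      apply: connect_trans Cv' (connect1 _); apply/and3P; split; rewrite ?in_set1 //.
      by rewrite edge_sym //; apply: wt_sym.
    apply: (root_comp_step vK); apply/and3P; split=> //.
      by apply: root_comp_notin vK; rewrite !inE.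
    rewrite in_setU negb_or v'x in_set1; apply: contraNneq nC => <-.
    exact: Cv'.
  by move=> _; apply: root_in_comp.
move/implyP; apply; case: u xu {uK} => // u xu.
by apply: connect1; apply/and3P; split; rewrite ?in_set1.
Qed.

Lemma two_connected (a u v : option T) : u != a -> v != a ->
  connect (without w [set a]) u v.
Proof.
have csym S : connect_sym (without w S) by apply: without_csym; apply: wt_sym.
case: a => [x|].
  have reach z : z != Some x -> connect (without w [set Some x]) None z.
    case: z => [z|] zx; last exact: connect0.
    by have := @root_comp1 x z; rewrite inE; apply; apply: contraNneq zx => ->.
  by move=> ux vx; apply: (connect_trans (y := None)); [rewrite csym|]; apply: reach.
case: u => // u _; case: v => // v _.
have [uv|] := eqVneq (ty u) (ty v); last exact: connect_without_root.
have [z zu] := has_ty (~~ ty u).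
have uz : ty u != ty z by rewrite zu; case: (ty u).
apply: (connect_trans (connect_without_root uz)); rewrite csym.
by apply: connect_without_root; rewrite -uv.
Qed.

Let w_sym : forall u v, w u v = w v u := wt_sym G.
Let w_loopless : forall u, w u u = 0 := wt_loopless G.

Lemma rdeg_deg x : rdeg G x = deg w (Some x).
Proof.
rewrite /rdeg /root_wt /deg [RHS](bigID (mem (comp [set Some x]))) /=.
rewrite [X in _ = _ + X]big1 ?addn0 // => v vK.
have [->|vx] := eqVneq v (Some x); first exact: w_loopless.
case/negP: vK; rewrite inE; apply: two_connected => //.
Qed.

(** A pair is thus bad exactly when both its cutoffs are positive. *)
Lemma rwt2_cutoff x y : rwt2 G x y + cutoff None w (Some x) (Some y) = rdeg G x.
Proof.
rewrite rdeg_deg /rwt2 /root_wt /cutoff /deg.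
rewrite [RHS](bigID (mem (comp [set Some x; Some y]))) /=; congr (_ + _).
by apply: eq_bigl => v; rewrite in_setC.
Qed.

(** A positive cutoff means that the two vertices are adjacent or separate the graph, and both
    conditions are symmetric. *)
Lemma cutoff0C x y : x != y -> cutoff None w (Some x) (Some y) = 0 ->
  cutoff None w (Some y) (Some x) = 0.
Proof.
move=> xy c0; have [xr yr] : Some x != None /\ Some y != None by [].
have yx : Some y != Some x by rewrite eq_sym.
apply/eqP; rewrite -leqn0 leqNgt; apply/negP=> pos.
have nxy : ~~ edge_rel w (Some y) (Some x).
  rewrite edge_sym // /edge_rel -leqNgt -c0.
  exact: le_cutoff (comp_r w xr yr).
have [C sC] := exists_sepset w_sym w_loopless yr xr yx pos nxy.
by have := sepset_cutoff w_sym two_connected (sepsetC sC); rewrite c0.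
Qed.

(** For bad pairs this follows from [rwt2_ty]; for the others one cutoff vanishes, hence both. *)
Lemma cutoff_ty x y x' y' : x != y -> x' != y' -> ty x = ty x' -> ty y = ty y' ->
  cutoff None w (Some x) (Some y) = cutoff None w (Some x') (Some y').
Proof.
move=> xy x'y' tx ty_y.
have not_bad u v : u != v -> ~~ bad G u v -> cutoff None w (Some u) (Some v) = 0.
  have cut0 u' v' : rdeg G u' <= rwt2 G u' v' -> cutoff None w (Some u') (Some v') = 0.
    by rewrite -(rwt2_cutoff u' v') -[leqRHS]addn0 leq_add2l leqn0 => /eqP.
  move=> uv; rewrite negb_and -!leqNgt => /orP[/cut0//|/cut0].
  by apply: cutoff0C; rewrite eq_sym.
have [b|nb] := boolP (bad G x y).
  apply/eqP; rewrite -(eqn_add2l (rwt2 G x y)) rwt2_cutoff (rdeg_ty inv tx).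
  by rewrite (rwt2_ty inv tx ty_y xy x'y' b) rwt2_cutoff.
by rewrite !not_bad // -(bad_ty inv tx ty_y xy x'y').
Qed.

Lemma mixed_bad_cycle :
    (forall b, ~ forall x, ty x = b ->
      connect (fun u v => [&& oapp (fun x => ty x == b) true u,
                              oapp (fun x => ty x == b) true v & edge_rel w u v])
              None (Some x)) ->
  exists a, 0 < a /\ is_weighted_cycle G a.
Proof.
move=> disc; pose col (u : option T) := oapp ty true u.
have degE (u v : option T) : u != None -> v != None -> col u = col v -> deg w u = deg w v.
  by case: u v => [x|] // [y|] // _ _ xy; rewrite -!rdeg_deg (rdeg_ty inv xy).
have cutE (x y x' y' : option T) : x != None -> y != None -> x' != None -> y' != None ->
    x != y -> x' != y' -> col x = col x' -> col y = col y' ->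
    cutoff None w x y = cutoff None w x' y'.
  by case: x y x' y' => [x|] // [y|] // [x'|] // [y'|] // _ _ _ _; apply: cutoff_ty.
have cut_gt0 (x y : option T) : x != None -> y != None -> col x != col y ->
    0 < cutoff None w x y.
  case: x y => [x|] // [y|] // _ _ xy; have := mixed_rwt xy.
  by rewrite -(rwt2_cutoff x y) -[ltnLHS]addn0 ltn_add2l.
have [|a a0 [c cP]] :=
  two_connected_weighted_cycle w_sym w_loopless two_connected degE cutE cut_gt0.
  move=> b H; apply: (disc b) => x xb; have := H (Some x) isT xb.
  apply: connect_sub => u v uv; apply: connect1; move: uv.
  by case: u => [u|]; case: v => [v|].
by exists a; split=> //; exists c.
Qed.

End MixedBad.

End Coloured.

(** * Cycles of the component graph *)

Section ComponentGraph.

Variables (p q : nat) (G : rooted_graph ('I_p + 'I_q)%type).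
Notation T := ('I_p + 'I_q)%type.
Notation w := (wt G).

Definition in_A (x : T) : bool := if x is inl _ then true else false.

Definition side (b : bool) : {set option T} := if b then vertexA p q else vertexB p q.

Lemma mem_side b x : (Some x \in side b) = (in_A x == b).
Proof.
rewrite /side; case: b; apply/imsetP/idP; case: x => x //=;
  try (by case=> y _ []); by exists x.
Qed.

Lemma None_side b : None \notin side b.
Proof. by case: b; apply/imsetP; case. Qed.

Lemma induced_csym S : connect_sym (induced_adj G S).
Proof.
by apply: sym_connect_sym => u v; rewrite /induced_adj /adj wt_sym andbCA.
Qed.

Lemma comp_equivP x v : reflect
  (exists y, [/\ v = Some y, in_A y = in_A x &
    connect (induced_adj G (None |: side (in_A x))) (Some x) (Some y)])
  (comp_equiv G (Some x) v).
Proof.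
rewrite /comp_equiv /same_comp_in -[vertexA p q]/(side true) -[vertexB p q]/(side false).
rewrite !mem_side; apply: (iffP idP) => [|[y [-> yx]]]; last first.
  by rewrite !mem_side yx; case: (in_A x) => ->.
case: v => [y|]; last by rewrite !(negPf (None_side _)) !andbF.
by rewrite !mem_side => /or3P[//||] /and3P[/eqP-> /eqP yE xy]; exists y.
Qed.

Lemma comp_equiv_None v : comp_equiv G None v = (v == None).
Proof.
rewrite /comp_equiv /same_comp_in -[vertexA p q]/(side true) -[vertexB p q]/(side false).
by rewrite !(negPf (None_side _)) !orbF.
Qed.

Lemma comp_equiv_refl u : comp_equiv G u u.
Proof.
by case: u => [x|]; [apply/comp_equivP; exists x | rewrite comp_equiv_None].
Qed.

Lemma comp_equiv_sym u v : comp_equiv G u v -> comp_equiv G v u.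
Proof.
case: u => [x|]; last by rewrite comp_equiv_None => /eqP->; apply: comp_equiv_refl.
case/comp_equivP=> y [-> yx xy]; apply/comp_equivP; exists x; split=> //.
by rewrite yx induced_csym.
Qed.

Lemma comp_equiv_trans u v z : comp_equiv G u v -> comp_equiv G v z -> comp_equiv G u z.
Proof.
case: u => [x|]; last by rewrite comp_equiv_None => /eqP->.
case/comp_equivP=> y [-> yx xy] /comp_equivP[t [-> ty yt]].
apply/comp_equivP; exists t; split; rewrite ?ty //.
by apply: connect_trans xy _; rewrite -yx.
Qed.

Lemma comp_nodesP X : X \in comp_nodes G -> exists u, X = [set v | comp_equiv G u v].
Proof. by case/imsetP=> u _ ->; exists u; apply/setP=> v; rewrite !inE. Qed.

Lemma node_equiv X u v : X \in comp_nodes G -> u \in X -> (v \in X) = comp_equiv G u v.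
Proof.
case/comp_nodesP=> t ->; rewrite !inE => tu; apply/idP/idP => [tv|uv].
  exact: comp_equiv_trans (comp_equiv_sym tu) tv.
exact: comp_equiv_trans tu uv.
Qed.

Lemma node_eq X Y u : X \in comp_nodes G -> Y \in comp_nodes G -> u \in X -> u \in Y ->
  X = Y.
Proof.
by move=> Xn Yn uX uY; apply/setP=> v; rewrite (node_equiv _ Xn uX) (node_equiv _ Yn uY).
Qed.

Lemma node_neq0 X : X \in comp_nodes G -> exists u, u \in X.
Proof. by case/comp_nodesP=> u ->; exists u; rewrite inE comp_equiv_refl. Qed.

(** A node may be held together through the root, but every nonroot vertex on a connecting walk
    within its side belongs to the node and so differs from [x]. *)
Lemma node_connect X x u v : X \in comp_nodes G -> Some x \notin X ->
  u \in X -> v \in X -> connect (without w [set Some x]) u v.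
Proof.
move=> Xn xX uX; rewrite (node_equiv _ Xn uX).
case: u uX => [a|] aX; last by rewrite comp_equiv_None => /eqP->; apply: connect0.
case/comp_equivP=> b [-> _ ab].
pose R := induced_adj G (None |: side (in_A a)).
have avoid z : z \in None |: side (in_A a) -> connect R (Some a) z -> z != Some x.
  move=> zS az; apply: contraNneq xX => zx; rewrite (node_equiv _ Xn aX).
  apply/comp_equivP; exists x; rewrite zx in zS az; split=> //.
  by move: zS; rewrite in_setU1 mem_side => /eqP.
pose P z := connect R (Some a) z && connect (without w [set Some x]) (Some a) z.
suff /andP[] : P (Some b) by [].
apply: (connect_inv (P := P)) ab _; last by rewrite /P !connect0.
move=> z z' /andP[az az'] zz'; have az1 := connect_trans az (connect1 zz').
rewrite /P az1; apply: connect_trans az' (connect1 _).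
by case/and3P: zz' => zS z'S zz'; rewrite /without !in_set1 !avoid.
Qed.

Lemma comp_adj_sym : symmetric (comp_adj G).
Proof.
suff H X Y : comp_adj G X Y -> comp_adj G Y X by move=> X Y; apply/idP/idP; apply: H.
case/and4P=> Xn Yn XY /exists_inP[u uX /exists_inP[v vY uv]].
apply/and4P; split=> //; first by rewrite eq_sym.
by apply/exists_inP; exists v => //; apply/exists_inP; exists u; rewrite // /adj wt_sym.
Qed.

(** Reachability from the root is carried from the last node of the path back to the first, each
    node being traversable without [x]. *)
Lemma connect_nodes x Y l : path (comp_adj G) Y l -> Y \in comp_nodes G ->
    all (fun Z : {set option T} => Some x \notin Z) (Y :: l) ->
    (forall v, v \in last Y l -> connect (without w [set Some x]) None v) ->
  forall v, v \in Y -> connect (without w [set Some x]) None v.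
Proof.
elim: l Y => [|Z l IHl] Y /=; first by move=> _ _ _ H.
case/andP=> /and4P[Yn Zn _ /exists_inP[u uY /exists_inP[z zZ uz]]] Zl _ /and3P[xY xZ xl] H v vY.
have rz := IHl Z Zl Zn _ H z zZ; rewrite /= xZ in rz.
apply: connect_trans (rz xl) _; apply: connect_trans (node_connect Yn xY uY vY).
apply: connect1; rewrite /without !in_set1 edge_sym; last exact: wt_sym.
apply/and3P; split=> //; first by apply: contraNneq xZ => <-.
by apply: contraNneq xY => <-.
Qed.

(* On a cycle [X0, X1, X2, ..] of the component graph, let [X0] be where a path
   from the root first meets the cycle; an edge between [X1] and [X2] is then
   of mixed type and neither of its ends separates the other from the root. *)
Lemma cycle_bad : has_cycle (comp_adj G) ->
  exists x y, in_A x != in_A y /\ bad G x y.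
Proof.
case=> c c2 /andP[cyc uq].
pose W := [set v | has (fun X : {set option T} => v \in X) c].
have nodes X : X \in c -> X \in comp_nodes G.
  by move=> Xc; have /and4P[] := next_cycle cyc Xc.
have memW X v : X \in c -> v \in X -> v \in W.
  by move=> Xc vX; rewrite inE; apply/hasP; exists X.
have [v vW] : exists v, v \in W.
  have [X Xc] : exists X, X \in c by case: (c) c2 => // X l _; exists X; rewrite mem_head.
  by have [u uX] := node_neq0 (nodes X Xc); exists u; apply: memW uX.
have [h hW [hN hit]] := first_hit (wt_connected G None v) vW.
have [X0 X0c hX0] : exists2 X, X \in c & h \in X by apply/hasP; rewrite inE in hW.
have [i s rotE] := rot_to X0c.
have memc X : X \in X0 :: s -> X \in c by rewrite -rotE mem_rot.
have {}uq : uniq (X0 :: s) by rewrite -rotE rot_uniq.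
have {}cyc : path.cycle (comp_adj G) (X0 :: s) by rewrite -rotE rot_cycle.
have : 2 < size (X0 :: s) by rewrite -rotE size_rot.
case: s {rotE} memc uq cyc => [|X1 [|X2 s]] // memc uq cyc _.
have disj X Y z : X \in X0 :: X1 :: X2 :: s -> Y \in X0 :: X1 :: X2 :: s -> X != Y ->
    z \in X -> z \notin Y.
  move=> Xs Ys XY zX; apply: contraNN XY => zY; apply/eqP.
  exact: node_eq (nodes _ (memc _ Xs)) (nodes _ (memc _ Ys)) zX zY.
have [i0 i1 i2] : [/\ X0 \in X0 :: X1 :: X2 :: s, X1 \in X0 :: X1 :: X2 :: s
                   & X2 \in X0 :: X1 :: X2 :: s] by rewrite !in_cons !eqxx !orbT.
have [n01 n02 n12] : [/\ X0 != X1, X0 != X2 & X1 != X2].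
  move: uq; rewrite /= !in_cons !negb_or => /and4P[/and3P[-> -> _] /andP[-> _] _ _].
  by [].
have reach0 x X : X \in X0 :: X1 :: X2 :: s -> X != X0 -> Some x \in X ->
    forall z, z \in X0 -> connect (without w [set Some x]) None z.
  move=> Xs XX0 xX z zX0; have xX0 := disj _ _ _ Xs i0 XX0 xX.
  have xh : Some x != h by apply: contraNneq xX0 => ->.
  apply: connect_trans (hit _ (memW _ _ (memc _ Xs) xX) xh) _.
  exact: node_connect (nodes _ X0c) xX0 hX0 zX0.
move: cyc; rewrite /= rcons_path => /and4P[a01 a12 path2 last2].
have [u uX1 [v' v'X2 uv]] : exists2 u, u \in X1 & exists2 v', v' \in X2 & adj G u v'.
  case/and4P: a12 => _ _ _ /exists_inP[u uX1 /exists_inP[v' v'X2 uv]].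
  by exists u => //; exists v'.
(* If the root lies on the cycle, then [h] is the root, so its node is [X0]. *)
have noNone X : X \in X0 :: X1 :: X2 :: s -> X != X0 -> None \notin X.
  move=> Xs XX0; apply/negP=> NX; have := hN (memW _ _ (memc _ Xs) NX) => hE.
  by have := disj _ _ _ Xs i0 XX0 NX; rewrite -hE hX0.
case: u uX1 uv => [x|] uX1; last by rewrite (negPf (noNone X1 _ _)) // eq_sym in uX1.
case: v' v'X2 => [y|] yX2 uv; last by rewrite (negPf (noNone X2 _ _)) // eq_sym in yX2.
(* Adjacent vertices of one side would share a node. *)
have xy : in_A x != in_A y.
  apply: contraNneq n12 => xy; apply/eqP.
  apply: (node_eq (nodes _ (memc _ i1)) (nodes _ (memc _ i2)) _ yX2).
  rewrite (node_equiv _ (nodes _ (memc _ i1)) uX1); apply/comp_equivP; exists y; split=> //.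
  by apply: connect1; rewrite /induced_adj !in_setU1 !mem_side xy eqxx !orbT.
exists x, y; split=> //; apply: contraT => nb.
have := edge_cut uv nb; rewrite !inE.
(* Going from [X0] to [X2] the long way round the cycle avoids [X1], the node of [x]. *)
have -> : connect (without w [set Some x]) None (Some y).
  have x_s Y : Y \in X2 :: rcons s X0 -> Some x \notin Y.
    rewrite in_cons mem_rcons in_cons => Ys; apply: (disj X1) => //.
      by rewrite !in_cons; case/or3P: Ys => ->; rewrite ?orbT.
    case/or3P: Ys => [/eqP->|/eqP->|Ys]; rewrite // 1?eq_sym //.
    apply: contraTneq uq => E; rewrite E in Ys.
    by rewrite /= [X1 \in X2 :: s]in_cons Ys orbT andbF.
  apply: (@connect_nodes x X2 (rcons s X0)) => //.
  - by rewrite rcons_path path2.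
  - exact: nodes (memc _ i2).
  - by apply/allP.
  by rewrite last_rcons; apply: reach0 i1 _ uX1; rewrite eq_sym.
(* The direct step from [X0] to [X1] avoids [X2], the node of [y]. *)
have -> // : connect (without w [set Some y]) None (Some x).
apply: (@connect_nodes y X1 [:: X0]) => //=.
- by rewrite comp_adj_sym a01.
- exact: nodes (memc _ i1).
- by rewrite (disj X2 X1) 1?eq_sym // (disj X2 X0) // eq_sym.
by apply: reach0 i2 _ yX2; rewrite eq_sym.
Qed.

End ComponentGraph.

Theorem theorem6p19 (p q : nat) (G : rooted_graph ('I_p + 'I_q)%type) :
  typeII G -> has_cycle (comp_adj G) ->
  exists a : nat, 0 < a /\ is_weighted_cycle G a.
Proof.
case=> [[p0 q0] discA discB PF] /cycle_bad[x0 [y0 [xy0 bad0]]].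
have inv (x y : 'I_p + 'I_q) b : in_A x = in_A y ->
    parking G (b \o tperm x y) <-> parking G b.
  case: x y => [i|i] [j|j] // _.
    rewrite -(PF (tperm i j) 1%g b); apply: eq_parking => -[k|k] /=.
      by congr b; case: (tpermP i j k) => [->|->|n1 n2];
        rewrite ?tpermL ?tpermR ?tpermD //; apply/eqP=> -[]/esym.
    by rewrite perm1 tpermD.
  rewrite -(PF 1%g (tperm i j) b); apply: eq_parking => -[k|k] /=.
    by rewrite perm1 tpermD.
  by congr b; case: (tpermP i j k) => [->|->|n1 n2];
    rewrite ?tpermL ?tpermR ?tpermD //; apply/eqP=> -[]/esym.
have badC x y : bad G x y = bad G y x by rewrite /bad andbC.
have xy_neq (x y : 'I_p + 'I_q) : in_A x != in_A y -> x != y.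
  by apply: contraNneq => ->.
apply: (mixed_bad_cycle inv).
(* One bad mixed pair makes all mixed pairs bad, up to exchanging the two vertices. *)
- move=> x y xy; have [x0x|x0x] := eqVneq (in_A x0) (in_A x).
    rewrite -(bad_ty inv x0x _ (xy_neq _ _ xy0) (xy_neq _ _ xy)) //.
    by move: xy0 xy; rewrite x0x; case: (in_A x) (in_A y0) (in_A y) => [] [] [].
  rewrite badC -(bad_ty inv _ _ (xy_neq _ _ xy0)) //.
  - by move: x0x xy; case: (in_A x) (in_A x0) (in_A y) => [] [] [].
  - by move: x0x xy0; case: (in_A x) (in_A x0) (in_A y0) => [] [] [].
  by apply: xy_neq; rewrite eq_sym.
- by case; [exists (inl (Ordinal p0)) | exists (inr (Ordinal q0))].
move=> b H; have : induced_connected G (None |: side p q b); last by case: b H.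
have conn u : u \in None |: side p q b ->
    connect (induced_adj G (None |: side p q b)) None u.
  case: u => [x|_]; last exact: connect0.
  rewrite in_setU1 mem_side => /eqP xb; apply: connect_sub (H x xb) => u v.
  have inS z : oapp (fun x => in_A x == b) true z -> z \in None |: side p q b.
    by case: z => [z|] /= zb; rewrite in_setU1 // mem_side zb orbT.
  by case/and3P=> /inS ub /inS vb uv; apply/connect1/and3P.
by move=> u v uS vS; apply: connect_trans (conn v vS); rewrite induced_csym; apply: conn.
Qed.
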